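(* Let $\mathcal H$ and $\mathcal G$ be real Hilbert spaces, let $z\in\mathcal H$, let $r\in\mathcal G$, let $f\colon\mathcal H\to\,]-\infty,+\infty]$ and $g\colon\mathcal G\to\,]-\infty,+\infty]$ be lower semicontinuous convex functions, and let $L\colon\mathcal H\to\mathcal G$ be a nonzero bounded linear operator such that $r\in\operatorname{sri}\big(L(\operatorname{dom}f)-\operatorname{dom}g\big)$. Consider the primal problem $$\underset{x\in\mathcal H}{\text{minimize}}\;\; f(x)+g(Lx-r)+\tfrac12\|x-z\|^2,\qquad (P)$$ and the dual problem $$\underset{v\in\mathcal G}{\text{minimize}}\;\;\widetilde{f^*}(z-L^*v)+g^*(v)+\langle v\mid r\rangle.\qquad (D)$$ Let $x$ be the unique solution to $(P)$. Let $(a_n)_{n\in\mathbb N}$ be a sequence in $\mathcal G$ with $\sum_{n\in\mathbb N}\|a_n\|<+\infty$, let $(b_n)_{n\in\mathbb N}$ be a sequence in $\mathcal H$ with $\sum_{n\in\mathbb N}\|b_n\|<+\infty$, let $\varepsilon\in\,]0,\min\{1,\|L\|^{-2}\}[$, let $v_0\in\mathcal G$, let $(\gamma_n)_{n\in\mathbb N}$ be a sequence in $[\varepsilon,2\|L\|^{-2}-\varepsilon]$, let $(\lambda_n)_{n\in\mathbb N}$ be a sequence in $[\varepsilon,1]$, and define, for every $n\in\mathbb N$, $$x_n=\operatorname{prox}_f(z-L^*v_n)+b_n,\qquad v_{n+1}=v_n+\lambda_n\Big(\operatorname{prox}_{\gamma_n g^*}\big(v_n+\gamma_n(Lx_n-r)\big)+a_n-v_n\Big).$$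 Then the following hold. (i) $(v_n)_{n\in\mathbb N}$ converges weakly to a solution $v$ to $(D)$, and $x=\operatorname{prox}_f(z-L^*v)$. (ii) $(x_n)_{n\in\mathbb N}$ converges strongly to $x$.
   Context: For a function $\varphi$ with values in $]-\infty,+\infty]$, $\operatorname{dom}\varphi=\{x : \varphi(x)<+\infty\}$. For a nonempty convex set $C$ in a Hilbert space, $\operatorname{cone}C=\bigcup_{\lambda>0}\{\lambda x: x\in C\}$, and the strong relative interior is $\operatorname{sri}C=\{x\in C:\operatorname{cone}(C-x)=\overline{\operatorname{span}}(C-x)\}$, where $\overline{\operatorname{span}}$ is the closed linear span (and $\operatorname{sri}\varnothing=\varnothing$). For $\varphi$ proper, lower semicontinuous and convex on a real Hilbert space: $\varphi^*(u)=\sup_x\langle x\mid u\rangle-\varphi(x)$ is its conjugate; $\widetilde{\varphi}(x)=\min_y\varphi(y)+\frac12\|x-y\|^2$ is its Moreau envelope (so $\widetilde{f^*}$ is the Moreau envelope of $f^*$); and $\operatorname{prox}_\varphi x$ is the unique minimizer of $y\mapsto\varphi(y)+\frac12\|x-y\|^2$. $L^*$ denotes the adjoint of $L$. The hypothesis $r\in\operatorname{sri}(L(\operatorname{dom}f)-\operatorname{dom}g)$ implies that $f$ and $g$ are proper and that $(P)$ has exactly one solution. *)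

(* Defs.v *)
From HB Require Import structures.
From mathcomp Require Import all_boot all_order all_algebra.
From mathcomp Require Import all_classical all_reals all_analysis.

Set Implicit Arguments.
Unset Strict Implicit.
Unset Printing Implicit Defensive.

Import Order.TTheory GRing.Theory Num.Theory.
Import numFieldNormedType.Exports.

Local Open Scope classical_set_scope.
Local Open Scope ring_scope.

HB.mixin Record NormedModule_hasDot (R : realType) V & NormedModule R V := {
  dotp : V -> V -> R ;
  dotpC : forall x y, dotp x y = dotp y x ;
  dotpDl : forall x y z, dotp (x + y) z = dotp x z + dotp y z ;
  dotpZl : forall (a : R) x y, dotp (a *: x) y = a * dotp x y ;
  dotpxx : forall x, dotp x x = `|x| ^+ 2
}.

#[short(type="hilbertType")]
HB.structure Definition Hilbert (R : realType) :=
  {V of CompleteNormedModule R V & NormedModule_hasDot R V}.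

Section convex_analysis.
Context {R : realType} {V : hilbertType R}.
Implicit Types (phi : V -> \bar R) (C : set V).

(* In the arithmetic of \bar R, 0 * +oo = 0 and -oo + +oo = -oo: this is the
   usual convexity for functions that never take the value -oo. *)
Definition econvex phi := forall (t : R) (x y : V), 0 <= t <= 1 ->
  (phi (t *: x + (1 - t) *: y)%R <= t%:E * phi x + (1 - t)%:E * phi y)%E.

Definition edom phi : set V := [set x | (phi x < +oo)%E].

Definition cone C : set V :=
  \bigcup_(l in [set l : R | 0 < l]) [set l *: x | x in C].

Definition lspan C : set V :=
  smallest [set S : set V | submod_closed (mem S)] C.

Definition sri C : set V := [set x | C x /\
  cone [set y - x | y in C] = closure (lspan [set y - x | y in C])].

Definition minimizers phi : set V := [set x | forall y, (phi x <= phi y)%E].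

Definition conjugate phi (u : V) : \bar R :=
  ereal_sup [set ((dotp x u)%:E - phi x)%E | x in [set: V]].

Definition moreau_objective phi (x y : V) : \bar R :=
  (phi y + (2^-1 * `|x - y| ^+ 2)%:E)%E.

(* The infimum is attained when phi is proper, lower semicontinuous and
   convex. *)
Definition moreau_envelope phi (x : V) : \bar R :=
  ereal_inf (range (moreau_objective phi x)).

(* The default value 0 is irrelevant when phi is proper, lower semicontinuous
   and convex: there is then exactly one minimizer. *)
Definition prox phi (x : V) : V := xget 0 (minimizers (moreau_objective phi x)).

Definition weakly_cvg (u : nat -> V) (l : V) :=
  forall w, dotp (u n) w @[n --> \oo] --> dotp l w.

End convex_analysis.

Section operators.
Context {R : realType} {H G : hilbertType R}.
Implicit Type L : H -> G.

Definition bounded_operator L := exists M : R, forall x, `|L x| <= M * `|x|.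

Definition opnorm L : R := sup [set `|L x| | x in [set x : H | `|x| <= 1]].

(* For L bounded and linear, the vector h below exists (Riesz) and is unique,
   so that the default value 0 is irrelevant. *)
Definition adjoint L (y : G) : H :=
  xget 0 [set h | forall x, dotp (L x) y = dotp x h].

Definition primal (f : H -> \bar R) (g : G -> \bar R) L (z : H) (r : G)
    (x : H) : \bar R :=
  (f x + g (L x - r)%R + (2^-1 * `|x - z| ^+ 2)%:E)%E.

Definition dual (f : H -> \bar R) (g : G -> \bar R) L (z : H) (r : G)
    (v : G) : \bar R :=
  (moreau_envelope (conjugate f) (z - adjoint L v)%R + conjugate g v
   + (dotp v r)%:E)%E.

End operators.

(* Main.v *)
Require Import Defs.
From HB Require Import structures.
From mathcomp Require Import all_boot all_order all_algebra.
From mathcomp Require Import all_classical all_reals all_analysis.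
From mathcomp Require Import ring lra.

(** A pair [(x, v)] with [z - x - L^* v] in the subdifferential of [f] at [x]
    and [v] in that of [g] at [L x - r] consists of the primal solution and of a
    dual solution.  Such a pair is obtained by penalizing the constraint
    [L u - r = p] in the minimization of [f u + g p + |u - z|^2 / 2]: under the
    qualification condition the approximate multipliers are pointwise bounded
    on the closed subspace they live in, hence bounded (Banach-Steinhaus), and
    one passes to the limit, strongly in [u] and weakly in the multipliers.

    The algorithm is a forward-backward iteration on the dual.  Firm
    nonexpansiveness of the two proximity operators makes [|v_n - v|^2]
    decrease, up to summable errors, by a multiple of [|prox_f (z - L^* v_n) - x|^2]
    plus a multiple of the squared forward-backward residual, for every such
    [v].  Both terms thus tend to [0]; the first gives the strong convergence of
    [x_n] and the second makes every weak limit point of [v_n] such a [v], so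
    that Opial's argument applies.  Weak compactness is used along ultrafilters,
    which avoids the extraction of subsequences. *)
Set Implicit Arguments.
Unset Strict Implicit.
Unset Printing Implicit Defensive.

Import Order.TTheory GRing.Theory Num.Theory.
Import numFieldNormedType.Exports.

Local Open Scope classical_set_scope.
Local Open Scope ring_scope.

(** * Algebra of the inner product and the Cauchy-Schwarz inequality *)

Section hilbert_algebra.
Context {R : realType} {V : hilbertType R}.
Implicit Types (x y z : V) (a : R).

Lemma dotpDr x y z : dotp x (y + z) = dotp x y + dotp x z.
Proof. by rewrite dotpC dotpDl ![dotp _ x]dotpC. Qed.

Lemma dotpZr a x y : dotp x (a *: y) = a * dotp x y.
Proof. by rewrite dotpC dotpZl dotpC. Qed.

Lemma dotpNl x y : dotp (- x) y = - dotp x y.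
Proof. by rewrite -scaleN1r dotpZl mulN1r. Qed.

Lemma dotpNr x y : dotp x (- y) = - dotp x y.
Proof. by rewrite dotpC dotpNl dotpC. Qed.

Lemma dotp0l x : dotp 0 x = 0.
Proof. by rewrite -(scale0r 0) dotpZl mul0r. Qed.

Lemma dotp0r x : dotp x 0 = 0.
Proof. by rewrite dotpC dotp0l. Qed.

Definition dotpE := (@dotpDl R V, dotpDr, dotpNl, dotpNr, @dotpZl R V, dotpZr).

Lemma dotp_ge0 x : 0 <= dotp x x.
Proof. by rewrite dotpxx sqr_ge0. Qed.

Lemma dotpxx_eq0 x : dotp x x = 0 -> x = 0.
Proof. by rewrite dotpxx => /eqP; rewrite sqrf_eq0 normr_eq0 => /eqP. Qed.

Lemma dotp_inj x y : (forall w, dotp x w = dotp y w) -> x = y.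
Proof.
move=> xy; apply/eqP; rewrite -subr_eq0; apply/eqP; apply: dotpxx_eq0.
by rewrite dotpDl dotpNl xy subrr.
Qed.

Lemma dotp_le x y : dotp x y <= `|x| * `|y|.
Proof.
have [->|x0] := eqVneq x 0; first by rewrite dotp0l normr0 mul0r.
have [->|y0] := eqVneq y 0; first by rewrite dotp0r normr0 mulr0.
(* The expansion of this square is [2 |x| |y| (|x| |y| - dotp x y)]. *)
have := dotp_ge0 (`|y| *: x - `|x| *: y).
rewrite !dotpE !dotpxx [dotp y x]dotpC => h.
have xy0 : 0 < `|x| * `|y| by rewrite mulr_gt0 ?normr_gt0.
rewrite -(ler_pM2l xy0); nra.
Qed.

Lemma normr_dotp_le x y : `|dotp x y| <= `|x| * `|y|.
Proof. by rewrite ler_norml dotp_le lerNl -dotpNl -[`|x|]normrN dotp_le. Qed.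

End hilbert_algebra.

(** This shape of bound comes from strong convexity for minimizing sequences and from monotonicity
    of subgradients for the penalized problems; [d] tending to [0] makes [u] Cauchy. *)
Lemma cvgn_sqr_bound {R : realType} (V : completeNormedModType R) (u : nat -> V)
    (d : nat -> R) :
  d n @[n --> \oo] --> 0 ->
  (forall n m, `|u n - u m| ^+ 2 <= d n + d m) -> cvgn u.
Proof.
move=> d0 ud; apply/cauchy_cvgP/cauchyP => e e0.
have e20 : 0 < e ^+ 2 / 2 by rewrite divr_gt0// exprn_gt0.
move/cvgrPdist_lt : d0 => /(_ _ e20) [N _ dN].
exists (u N); exists N => // n /= Nn; rewrite -ball_normE /= -(@ltr_pXn2r _ 2)// ?nnegrE ?normr_ge0 ?(ltW e0)//.
apply: (le_lt_trans (ud _ _)).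
have := dN _ Nn; have := dN N (leqnn N).
rewrite /= !sub0r !normrN !ltr_norml => /andP[_ ?] /andP[_ ?]; lra.
Qed.

(** * Limits of inner products along a filter of indices *)

Section filter_limits.
Context {R : realType} {V W : hilbertType R} (F : set_system nat).
Context {FF : ProperFilter F}.

Lemma cvg_normB0 (u : nat -> V) (l : V) :
  u n @[n --> F] --> l -> `|u n - l| @[n --> F] --> 0.
Proof.
by move=> ul; rewrite -(@normr0 _ V) -(subrr l); apply: cvg_norm; apply: cvgB => //; apply: cvg_cst.
Qed.

Lemma cvg_of_normB0 (u : nat -> V) (l : V) (e : nat -> R) :
  (forall n, `|u n - l| <= e n) -> e n @[n --> F] --> 0 -> u n @[n --> F] --> l.
Proof.
move=> ue e0; apply/cvgrPdist_lt => d d0.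
move/cvgrPdist_lt : e0 => /(_ _ d0); apply: filterS => n; rewrite sub0r normrN => h.
rewrite distrC; apply: (le_lt_trans (ue n)).
exact: le_lt_trans (ler_norm _) h.
Qed.

Lemma cvg_dotp_strong_weak (u v : nat -> V) (u0 v0 : V) (M : R) :
  u n @[n --> F] --> u0 -> (forall n, `|v n| <= M) ->
  (forall w, dotp (v n) w @[n --> F] --> dotp v0 w) ->
  dotp (u n) (v n) @[n --> F] --> dotp u0 v0.
Proof.
move=> uu0 vM vv0.
have h : dotp (u n - u0) (v n) @[n --> F] --> 0.
  apply/norm_cvg0P; apply: (@squeeze_cvgr _ _ _ _ (cst 0) (fun n => `|u n - u0| * M)).
  - near=> n; rewrite /= normr_ge0 (le_trans (normr_dotp_le _ _))//.
    by rewrite ler_wpM2l.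
  - exact: cvg_cst.
  - by rewrite -(mul0r M); apply: cvgM; [exact: cvg_normB0|exact: cvg_cst].
have -> : (fun n => dotp (u n) (v n)) =
          (fun n => dotp (u n - u0) (v n) + dotp (v n) u0).
  by apply/funext => n; rewrite dotpDl dotpNl (dotpC (v n)) subrK.
by rewrite -(add0r (dotp u0 v0)); apply: cvgD => //; rewrite dotpC.
Unshelve. all: by end_near. Qed.

Lemma cvg_dotp (u v : nat -> V) (u0 v0 : V) :
  u n @[n --> F] --> u0 -> v n @[n --> F] --> v0 ->
  dotp (u n) (v n) @[n --> F] --> dotp u0 v0.
Proof.
move=> uu vv.
suff h : dotp (u n) (v n) - dotp u0 v0 @[n --> F] --> 0.
  rewrite -(add0r (dotp u0 v0)).
  under eq_fun do rewrite -(subrK (dotp u0 v0) (dotp _ _)).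
  by apply: cvgD => //; apply: cvg_cst.
apply/norm_cvg0P; apply: (@squeeze_cvgr _ _ _ _ (cst 0)
   (fun n => `|u n - u0| * `|v n| + `|u0| * `|v n - v0|)).
- near=> n; rewrite /= normr_ge0/=.
  have -> : dotp (u n) (v n) - dotp u0 v0 = dotp (u n - u0) (v n) + dotp u0 (v n - v0).
    by rewrite !dotpE; ring.
  by rewrite (le_trans (ler_normD _ _))// lerD// normr_dotp_le.
- exact: cvg_cst.
- have -> : 0 = 0 * `|v0| + `|u0| * 0 by rewrite mul0r mulr0 addr0.
  by apply: cvgD; apply: cvgM; [exact: cvg_normB0|exact: cvg_norm|exact: cvg_cst|exact: cvg_normB0].
Unshelve. all: by end_near. Qed.

End filter_limits.

(** * Direct method for strongly convex functions, radial minorants, subgradients *)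

Lemma lsc_lim_le {R : realType} (T : topologicalType) (phi : T -> \bar R)
    (F : set_system nat) {FF : ProperFilter F} (u : nat -> T) (l : T)
    (c : nat -> R) (c0 : R) (A : \bar R) :
  lower_semicontinuous phi -> u n @[n --> F] --> l -> c n @[n --> F] --> c0 ->
  (forall n, (phi (u n) + (c n)%:E <= A)%E) -> (phi l + c0%:E <= A)%E.
Proof.
move=> phil ul cc0 uA.
(* A real [t] below [phi l] stays below [phi (u n)] eventually, so the limit is taken among reals;
   [t] then increases to [phi l], which may be infinite. *)
have h (t : R) : (t%:E < phi l)%E -> ((t + c0)%:E <= A)%E.
  move=> /(phil l t) [X lX Xt].
  have tF : \forall n \near F, ((t + c n)%:E <= A)%E.
    have : \forall n \near F, X (u n) by exact: ul.
    apply: filterS => n /Xt tn.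
    by rewrite (le_trans _ (uA n))// EFinD leeD2r// ltW.
  case: A tF {uA} => [a| |] tF; last by have [n] := filter_ex tF.
    rewrite lee_fin; apply: (@cvgr_to_le _ F _ _ (fun n => t + c n)).
    - by apply: cvgD; [exact: cvg_cst|exact: cc0].
    - by move: tF; apply: filterS => n; rewrite lee_fin.
  by rewrite leey.
case: (phi l) h => [b| |] h.
- apply/lee_addgt0Pr => e e0; apply: (@le_trans _ _ ((b - e + c0)%:E + e%:E)%E).
    by rewrite -!EFinD lee_fin; lra.
  by rewrite leeD2r// h// lte_fin; lra.
- rewrite addye// leye_eq; apply/eqP/eq_infty => t.
  by have := h (t - c0); rewrite ltry subrK; apply.
- by rewrite leNye.
Qed.

(** Midpoint strong convexity makes any minimizing sequence Cauchy, and lower semicontinuity makes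
    its limit a minimizer. Completeness enters as a hypothesis on sequences, so that the result
    applies to the product [H * G] with its max norm. *)
Lemma strongly_convex_minimizer {R : realType} (V : normedModType R)
    (Phi : V -> \bar R) (c m : R) :
  (forall (u : nat -> V) (d : nat -> R), d n @[n --> \oo] --> 0 ->
    (forall i j, `|u i - u j| ^+ 2 <= d i + d j) -> cvgn u) ->
  0 < c -> lower_semicontinuous Phi -> (forall x, (m%:E <= Phi x)%E) ->
  (exists x, (Phi x < +oo)%E) ->
  (forall x y (a b : R), (Phi x <= a%:E)%E -> (Phi y <= b%:E)%E ->
    (Phi (2^-1 *: (x + y))%R + (c * `|x - y| ^+ 2)%:E <= ((a + b) / 2)%:E)%E) ->
  exists x, Phi x \is a fin_num /\ forall y, (Phi x <= Phi y)%E.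
Proof.
move=> Vc c0 lPhi mPhi [x0 x0oo] cPhi.
have [i iE] : exists i : R, ereal_inf (range Phi) = i%:E.
  have h1 : (m%:E <= ereal_inf (range Phi))%E.
    by apply: le_ereal_inf_tmp => _ [y _ <-].
  have h2 : (ereal_inf (range Phi) < +oo)%E.
    by apply: le_lt_trans x0oo; apply: ereal_inf_lbound; exists x0.
  by case: ereal_inf h1 h2 => // i _ _; exists i.
have iPhi y : (i%:E <= Phi y)%E by rewrite -iE; apply: ereal_inf_lbound; exists y.
have /choice[u uP] : forall n, exists y, (Phi y <= (i + n.+1%:R^-1)%:E)%E.
  move=> n; have : (ereal_inf (range Phi) < (i + n.+1%:R^-1)%:E)%E.
    by rewrite iE lte_fin ltrDl invr_gt0.
  by move=> /ereal_inf_lt [_ [y _ <-] /ltW ?]; exists y.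
have inv0 : (n.+1%:R^-1 : R) @[n --> \oo] --> (0 : R) by exact: cvg_harmonic.
(* [u n] is within [n.+1%:R^-1] of the infimum, so the midpoint inequality bounds [c |u i - u j|^2]
   by half the sum of the two gaps; hence the factor [(2 * c)^-1]. *)
have /Vc : (2 * c)^-1 * n.+1%:R^-1 @[n --> \oo] --> 0.
  by rewrite -(mulr0 (2 * c)^-1); apply: cvgM => //; apply: cvg_cst.
move=> /(_ u) uc.
have {uc}/cvg_ex[l ul] : cvgn u.
  apply: uc => n k; have := cPhi _ _ _ _ (uP n) (uP k).
  move=> /(le_trans (leeD2r _ (iPhi _))); rewrite -EFinD lee_fin => h.
  rewrite -mulrDr ler_pdivlMl ?mulr_gt0//.
  move: h; set N := `|_|; set s := _^-1; set t := _^-1 => h.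
  lra.
exists l; suff h : (Phi l <= i%:E)%E.
  split; last by move=> y; apply: le_trans (iPhi y).
  by rewrite fin_numElt (lt_le_trans _ (iPhi l)) ?ltNyr//= (le_lt_trans h) ?ltry.
rewrite -(adde0 (Phi l)) -[0%E]/(0%:E) -oppr0.
apply: (lsc_lim_le (c := fun n => - n.+1%:R^-1) _ ul) => //; first exact: cvgN.
by move=> n; rewrite EFinN leeBlDr// -EFinD.
Qed.

Lemma cvgn_sqr_bound_pair {R : realType} (V W : completeNormedModType R)
    (u : nat -> ((V * W)%type : normedModType R)) (d : nat -> R) :
  d n @[n --> \oo] --> 0 ->
  (forall i j, `|u i - u j| ^+ 2 <= d i + d j) -> cvgn u.
Proof.
move=> d0 ud.
have h1 : cvgn (fun n => (u n).1).
  apply: (cvgn_sqr_bound d0) => i j; apply: le_trans (ud i j).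
  by rewrite ler_sqr ?nnegrE// prod_normE le_max lexx.
have h2 : cvgn (fun n => (u n).2).
  apply: (cvgn_sqr_bound d0) => i j; apply: le_trans (ud i j).
  by rewrite ler_sqr ?nnegrE// prod_normE le_max lexx orbT.
move: h1 h2 => /cvg_ex[a ua] /cvg_ex[b ub]; apply/cvg_ex; exists (a, b).
have -> : u = (fun n => ((u n).1, (u n).2)) by apply/funext => n; case: (u n).
exact: cvg_pair.
Qed.

(** No separation theorem is involved: lower semicontinuity bounds [phi] below on a ball around a
    point [x0] of its domain, and convexity on the segment from [x0] to [y], used where it crosses
    the sphere of radius [d], carries the bound outwards with slope [1 / d]. *)
Lemma radial_affine_minorant {R : realType} (V : hilbertType R) (phi : V -> \bar R) :
  (forall y, (-oo < phi y)%E) -> lower_semicontinuous phi -> econvex phi ->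
  exists A B : R, [/\ 0 <= A, 0 <= B & forall y, ((- A - B * `|y|)%:E <= phi y)%E].
Proof.
move=> phiNy phil phic.
have [[x0 x0oo]|nx] := pselect (exists x, (phi x < +oo)%E); last first.
  exists 0, 0; split => // y; suff -> : phi y = +oo%E by rewrite leey.
  apply/eqP; rewrite -leye_eq leNgt; apply/negP => h; apply: nx; by exists y.
have [p pE] : exists p : R, phi x0 = p%:E.
  by move: x0oo (phiNy x0); case: (phi x0) => // p _ _; exists p.
have := phil x0 (p - 1); rewrite pE lte_fin ltrBlDr ltrDl ltr01 => /(_ isT).
move=> [X /nbhs_ballP[e /= e0 eX] Xp].
pose d := e / 2; have d0 : 0 < d by rewrite divr_gt0.
have dX y : `|y - x0| <= d -> ((p - 1)%:E <= phi y)%E.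
  move=> yd; apply/ltW/Xp/eX; rewrite -ball_normE/= distrC (le_lt_trans yd)//.
  by rewrite /d; lra.
have key y : ((p - 1 - `|y - x0| / d)%:E <= phi y)%E.
  have [yd|yd] := leP `|y - x0| d.
    apply: le_trans (dX _ yd); rewrite lee_fin lerBlDr lerDl.
    by rewrite divr_ge0// ltW.
  have [phiy|phiy] := eqVneq (phi y) +oo%E; first by rewrite phiy leey.
  have [q qE] : exists q : R, phi y = q%:E.
    by move: phiy (phiNy y); case: (phi y) => // q _ _; exists q.
  set s := `|y - x0| in yd *.
  have s0 : 0 < s by rewrite (lt_trans d0).
  have t01 : 0 <= d / s <= 1.
    by rewrite divr_ge0 ?(ltW s0) ?(ltW d0)//= ler_pdivrMr// mul1r ltW.
  have := phic (d / s) y x0 t01.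
  have /dX : `|(d / s) *: y + (1 - d / s) *: x0 - x0| <= d.
    rewrite scalerBl scale1r addrCA addrAC subrr add0r -scalerBr normrZ.
    by move/andP: t01 => [/ger0_norm -> _]; rewrite -/s (divfK (lt0r_neq0 s0)).
  move=> h1 /(le_trans h1); rewrite pE qE -!EFinM -EFinD !lee_fin => h2.
  have : s / d * (p - 1) <= s / d * (d / s * q + (1 - d / s) * p).
    by rewrite ler_wpM2l// divr_ge0// ltW.
  have -> : s / d * (d / s * q + (1 - d / s) * p) = q + s / d * p - p.
    by field; rewrite !gt_eqF.
  by move=> h; nra.
exists (`|p - 1| + `|x0| / d), d^-1; split.
- by rewrite addr_ge0// divr_ge0// ltW.
- by rewrite invr_ge0 ltW.
move=> y; apply: le_trans (key y); rewrite lee_fin.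
have : `|y - x0| / d <= (`|y| + `|x0|) / d.
  by rewrite ler_pM2r ?invr_gt0// ler_normB.
have := ler_norm (- (p - 1)); rewrite normrN.
by rewrite mulrDl (mulrC d^-1); lra.
Qed.

(** Finiteness at [x] is built in because the inequality alone also holds where [phi x] is [-oo],
    and for the constant [+oo]. *)
Definition subgrad {R : realType} {V : hilbertType R} (phi : V -> \bar R) (x : V)
    : set V :=
  [set s | phi x \is a fin_num /\
           forall y, (phi x + (dotp (y - x) s)%:E <= phi y)%E].

(* Fermat's rule for a convex function plus a smooth one: the first-order upper
   expansion of [Q] at [p] is enough. *)
Lemma subgrad_of_minimizer {R : realType} {V : hilbertType R}
    (phi : V -> \bar R) (Q : V -> R) (p s : V) (K : V -> R) :
  (forall y, (-oo < phi y)%E) -> econvex phi -> phi p \is a fin_num ->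
  (forall y, (phi p + (Q p)%:E <= phi y + (Q y)%:E)%E) ->
  (forall d (t : R), 0 <= t <= 1 ->
     Q (p + t *: d) <= Q p - t * dotp d s + t ^+ 2 * K d) ->
  subgrad phi p s.
Proof.
move=> phiNy phic phip pmin QK; split => // y.
have [phiy|phiy] := eqVneq (phi y) +oo%E; first by rewrite phiy leey.
have [q qE] : exists q : R, phi y = q%:E.
  by move: phiy (phiNy y); case: (phi y) => // q _ _; exists q.
have [a aE] : exists a : R, phi p = a%:E by exists (fine (phi p)); rewrite fineK.
rewrite qE aE -EFinD lee_fin.
(* Minimality at [p + t (y - p)] and convexity on the segment, divided by [t]; letting [t] tend to
   [0] removes the second-order term. *)
have key (t : R) : 0 < t <= 1 -> a + dotp (y - p) s <= q + t * K (y - p).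
  move=> /andP[t0 t1].
  have t01 : 0 <= t <= 1 by rewrite ltW.
  have := phic t y p t01; have := pmin (t *: y + (1 - t) *: p).
  rewrite qE aE -!EFinM -!EFinD.
  have -> : t *: y + (1 - t) *: p = p + t *: (y - p).
    by rewrite scalerBl scale1r addrCA scalerBr.
  move=> h1 h2.
  have {h1 h2} := le_trans h1 (leeD2r (Q (p + t *: (y - p)))%:E h2).
  rewrite -EFinD lee_fin => h; have := QK (y - p) t t01 => h'.
  rewrite -(ler_pM2l t0); nra.
apply/ler_addgt0Pr => e e0.
pose M := `|K (y - p)| + 1.
have M0 : 0 < M by rewrite ltr_wpDl.
have t0 : 0 < Num.min 1 (e / M) by rewrite lt_min ltr01 divr_gt0.
have := key (Num.min 1 (e / M)); rewrite t0 ge_min lexx => /(_ isT) h.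
apply: (le_trans h); rewrite lerD2l.
have : Num.min 1 (e / M) * K (y - p) <= Num.min 1 (e / M) * M.
  by rewrite ler_wpM2l ?(ltW t0)// /M (le_trans (ler_norm _))// lerDl.
move=> /le_trans; apply; rewrite -[leRHS](divfK (lt0r_neq0 M0)).
by rewrite ler_pM2r// ge_min lexx orbT.
Qed.

Lemma ereal_real {R : realType} (a : \bar R) :
  (-oo < a)%E -> (a < +oo)%E -> exists r : R, a = r%:E.
Proof. by case: a => // r _ _; exists r. Qed.

(** * Stability of lower semicontinuity; bounded operators *)

Section lower_semicontinuity.
Context {R : realType} {T : topologicalType}.

Lemma lsc_comp {U : topologicalType} (phi : U -> \bar R) (h : T -> U) :
  lower_semicontinuous phi -> continuous h -> lower_semicontinuous (phi \o h).
Proof.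
move=> phil hc x a /phil[X Xhx Xa]; exists (h @^-1` X); first exact: hc.
by move=> y /Xa.
Qed.

Lemma lsc_continuous (h : T -> R) :
  continuous h -> lower_semicontinuous (fun x => (h x)%:E).
Proof.
move=> hc x a; rewrite lte_fin => ah.
exists [set y | a < h y]; last by move=> y /=; rewrite lte_fin.
exact: (cvgr_gt _ (hc x)).
Qed.

Lemma lsc_add (phi psi : T -> \bar R) :
  (forall x, (-oo < phi x)%E) -> (forall x, (-oo < psi x)%E) ->
  lower_semicontinuous phi -> lower_semicontinuous psi ->
  lower_semicontinuous (fun x => phi x + psi x)%E.
Proof.
move=> phiNy psiNy phil psil x a ax.
(* The threshold [a] is split as [b + (a - b)]; when both values are finite, each summand gets half
   of the slack. *)
have [b [bphi bpsi]] : exists b : R, (b%:E < phi x)%E /\ ((a - b)%:E < psi x)%E.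
  move: ax (phiNy x) (psiNy x); case: (phi x) => [p| |]//; case: (psi x) => [q| |]//.
  - rewrite -EFinD lte_fin => apq _ _; exists (p - (p + q - a) / 2).
    by rewrite !lte_fin; split; lra.
  - by move=> _ _ _; exists (p - 1); rewrite ltry lte_fin; split => //; lra.
  - by move=> _ _ _; exists (a - q + 1); rewrite ltry lte_fin; split => //; lra.
  - by move=> _ _ _; exists 0; rewrite !ltry.
have [X Xx Xb] := phil x b bphi; have [Y Yx Yb] := psil x (a - b) bpsi.
exists (X `&` Y); first exact: filterI.
move=> y [/Xb h1 /Yb h2]; have -> : a = b + (a - b) by ring.
by rewrite EFinD lteD.
Qed.

End lower_semicontinuity.

Lemma bounded_operator_continuous {R : realType} (H G : hilbertType R)
    (L : {linear H -> G}) : bounded_operator L -> continuous L.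
Proof.
move=> [M LM]; apply: bounded_linear_continuous; apply/linear_boundedP.
exists (`|M|); split; first exact: normr_real.
move=> N MN x; apply: (le_trans (LM x)); rewrite ler_wpM2r//.
by rewrite (le_trans (ler_norm M))// ltW.
Qed.

Lemma bounded_operator_gt0 {R : realType} (H G : hilbertType R)
    (L : H -> G) : bounded_operator L ->
  exists M : R, 0 < M /\ forall x, `|L x| <= M * `|x|.
Proof.
move=> [M LM]; exists (`|M| + 1); split; first by rewrite ltr_wpDl.
move=> x; apply: (le_trans (LM x)); rewrite ler_wpM2r//.
by rewrite (le_trans (ler_norm M))// lerDl.
Qed.

Lemma econvex_midpoint {R : realType} (V : hilbertType R) (phi : V -> \bar R)
    (x y : V) (p q : R) :
  econvex phi -> phi x = p%:E -> phi y = q%:E ->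
  (phi (2^-1 *: (x + y))%R <= ((p + q) / 2)%:E)%E.
Proof.
move=> phic px qy; have := phic 2^-1 x y; rewrite px qy -!EFinM -EFinD => h.
have -> : 2^-1 *: (x + y) = 2^-1 *: x + (1 - 2^-1) *: y.
  by rewrite scalerDr; congr (_ + _ *: _); lra.
apply: (le_trans (h _)); first by apply/andP; split; lra.
by rewrite lee_fin; lra.
Qed.

(** * Minimization with the constraint [L u - r = p] penalized *)

Section coupled_minimization.
Context {R : realType} (H G : hilbertType R).
Variables (f : H -> \bar R) (g : G -> \bar R) (L : {linear H -> G}) (z : H) (r : G).
Hypothesis f_gtNy : forall y, (-oo < f y)%E.
Hypothesis f_lsc : lower_semicontinuous f.
Hypothesis f_convex : econvex f.
Hypothesis g_gtNy : forall y, (-oo < g y)%E.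
Hypothesis g_lsc : lower_semicontinuous g.
Hypothesis g_convex : econvex g.
Hypothesis L_bounded : bounded_operator L.

Let Q k (u : H) (p : G) : R :=
  2^-1 * `|u - z| ^+ 2 + k / 2 * `|L u - r - p| ^+ 2.

(** Half of [Q] absorbs the radial minorants of [f] and [g]: both are bounded through [s] and [t],
    and completing the squares leaves the constants [(B + D * M) ^+ 2] and [D ^+ 2 / k]. *)
Lemma coupled_coercive (k : R) : 0 < k -> exists K : R, forall u p,
  ((- K + 2^-1 * Q k u p)%:E <= f u + g p + (Q k u p)%:E)%E.
Proof.
move=> k0.
have [A [B [A0 B0 fAB]]] := radial_affine_minorant f_gtNy f_lsc f_convex.
have [C [D [C0 D0 gCD]]] := radial_affine_minorant g_gtNy g_lsc g_convex.
have [M [M0 LM]] := bounded_operator_gt0 L_bounded.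
pose c := `|L z - r|.
exists (A + B * `|z| + C + D * c + (B + D * M) ^+ 2 + D ^+ 2 / k) => u p.
apply: le_trans (leeD2r _ (leeD (fAB u) (gCD p))).
rewrite -!EFinD lee_fin /Q; set s := `|u - z|; set t := `|L u - r - p|.
have us : `|u| <= s + `|z| by rewrite -{1}(subrK z u) ler_normD.
have pt : `|p| <= t + (M * s + c).
  have -> : p = - (L u - r - p) + (L (u - z) + (L z - r)).
    by rewrite (linearB L) (addrA (L u - L z)) subrK opprB subrK.
  apply: (le_trans (ler_normD _ _)); rewrite normrN lerD2l.
  by apply: (le_trans (ler_normD _ _)); rewrite lerD2r.
have h1 : B * `|u| <= B * (s + `|z|) by rewrite ler_wpM2l.
have h2 : D * `|p| <= D * (t + (M * s + c)) by rewrite ler_wpM2l.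
have h3 : 0 <= (s / 2 - (B + D * M)) ^+ 2 by rewrite sqr_ge0.
have h4 : 0 <= k * (t / 2 - D / k) ^+ 2 by rewrite mulr_ge0 ?sqr_ge0// ltW.
have h5 : k * (t / 2 - D / k) ^+ 2 = k / 4 * t ^+ 2 - D * t + D ^+ 2 / k.
  by field; rewrite gt_eqF.
rewrite h5 in h4; lra.
Qed.

(** The parallelogram law applied to both squares of [Q] yields the gain [d^2 / 8 + k E^2 / 8]. As
    [e <= E + M * d], this gain controls [e] as well as [d], whence a multiple of the squared max
    norm of the product. *)
Let coupled_midpoint (k M : R) : 0 < k -> 0 <= M ->
  (forall x, `|L x| <= M * `|x|) ->
  forall u p u' p',
  Q k (2^-1 *: (u + u')) (2^-1 *: (p + p')) +
   (8 * (1 + 2 * M ^+ 2) + 16 / k)^-1 * Num.max `|u - u'| `|p - p'| ^+ 2 <=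
  (Q k u p + Q k u' p') / 2.
Proof.
move=> k0 M0 LM u p u' p'.
have par (W : hilbertType R) (x y : W) : `|2^-1 *: (x + y)| ^+ 2 =
    (`|x| ^+ 2 + `|y| ^+ 2) / 2 - `|x - y| ^+ 2 / 4.
  by rewrite -!dotpxx !dotpE (dotpC y x); field.
have e1 : 2^-1 *: (u + u') - z = 2^-1 *: ((u - z) + (u' - z)).
  by rewrite addrACA -opprD (scalerBr _ (u + u')) -mulr2n -(scaler_nat 2 z) scalerA mulVf ?scale1r// pnatr_eq0.
have e2 : L (2^-1 *: (u + u')) - r - 2^-1 *: (p + p') =
    2^-1 *: ((L u - r - p) + (L u' - r - p')).
  rewrite (linearZ_LR L) (linearD L) (addrACA (L u - r)) (addrACA (L u)) -!opprD.
  by rewrite (scalerBr _ (_ + _ - _)) (scalerBr _ (_ + _)) -!mulr2n -(scaler_nat 2 r) scalerA mulVf ?scale1r// pnatr_eq0.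
rewrite /Q e1 e2 !par.
have -> : u - z - (u' - z) = u - u' by rewrite opprB addrA subrK.
have -> : L u - r - p - (L u' - r - p') = L (u - u') - (p - p').
  by rewrite (linearB L) !opprD !opprK addrACA (addrACA (L u)) addNr addr0.
set d := `|u - u'|; set e := `|p - p'|; set E := `|L (u - u') - (p - p')|.
have [d0 e0 E0] : [/\ 0 <= d, 0 <= e & 0 <= E] by split; exact: normr_ge0.
have eE : e <= E + M * d.
  rewrite /e (_ : p - p' = - (L (u - u') - (p - p')) + L (u - u')); last by rewrite opprB subrK.
  by rewrite (le_trans (ler_normD _ _))// normrN lerD2l.
have e2E : e ^+ 2 <= 2 * E ^+ 2 + 2 * M ^+ 2 * d ^+ 2.
  have : e ^+ 2 <= (E + M * d) ^+ 2 by apply: lerXn2r => //; rewrite nnegrE ?addr_ge0 ?mulr_ge0//.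
  have := sqr_ge0 (E - M * d); rewrite !expr2; lra.
have mx : Num.max d e ^+ 2 <= (1 + 2 * M ^+ 2) * d ^+ 2 + 2 * E ^+ 2.
  have := sqr_ge0 d; have := sqr_ge0 E; have := mulr_ge0 (sqr_ge0 M) (sqr_ge0 d).
  by case: (leP d e) => _; lra.
set c := 8 * _ + _.
have c0 : 0 < c by rewrite /c addr_gt0 ?divr_gt0// mulr_gt0// ltr_wpDr// mulr_ge0// sqr_ge0.
have h : c^-1 * Num.max d e ^+ 2 <= 8^-1 * d ^+ 2 + k / 8 * E ^+ 2.
  rewrite ler_pdivrMl// (le_trans mx)//.
  have ck : c * (k / 8) = k * (1 + 2 * M ^+ 2) + 2 by rewrite /c; field; rewrite gt_eqF.
  have c8 : c * 8^-1 = (1 + 2 * M ^+ 2) + 2 / k by rewrite /c; field; rewrite gt_eqF.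
  have -> : c * (8^-1 * d ^+ 2 + k / 8 * E ^+ 2) =
      c * 8^-1 * d ^+ 2 + c * (k / 8) * E ^+ 2 by ring.
  rewrite ck c8.
  have p1 : 0 <= 2 / k * d ^+ 2 by rewrite mulr_ge0 ?sqr_ge0// divr_ge0// ltW.
  have p2 : 0 <= k * (1 + 2 * M ^+ 2) * E ^+ 2.
    by rewrite mulr_ge0 ?sqr_ge0// mulr_ge0 ?(ltW k0)// addr_ge0// mulr_ge0// sqr_ge0.
  lra.
lra.
Qed.

Lemma coupled_minimizer (k : R) : 0 < k ->
  (exists u, (f u < +oo)%E) -> (exists p, (g p < +oo)%E) ->
  exists u p, [/\ f u \is a fin_num, g p \is a fin_num &
    forall u' p', (f u + g p + (Q k u p)%:E <= f u' + g p' + (Q k u' p')%:E)%E].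
Proof.
move=> k0 [u0 fu0] [p0 gp0].
have [M [M0 LM]] := bounded_operator_gt0 L_bounded.
have [K KQ] := coupled_coercive k0.
have Q0 u p : 0 <= Q k u p.
  by rewrite addr_ge0// mulr_ge0 ?sqr_ge0 ?invr_ge0// divr_ge0// ltW.
pose W : normedModType R := (H * G)%type.
pose Phi (w : W) := (f w.1 + g w.2 + (Q k w.1 w.2)%:E)%E.
pose c := (8 * (1 + 2 * M ^+ 2) + 16 / k)^-1.
have c0 : 0 < c.
  by rewrite invr_gt0 addr_gt0 ?divr_gt0// mulr_gt0// ltr_wpDr// mulr_ge0// sqr_ge0.
have fst_c : continuous (fst : W -> H) by move=> w; exact: cvg_fst.
have snd_c : continuous (snd : W -> G) by move=> w; exact: cvg_snd.
have Phi_lsc : lower_semicontinuous Phi.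
  apply: lsc_add => //.
  - by move=> w; move: (f_gtNy w.1) (g_gtNy w.2); case: (f _) => [p| |]//; case: (g _) => [q| |]// _ _; rewrite -EFinD ltNyr.
  - by move=> w; rewrite ltNyr.
  - apply: lsc_add => //; first exact: (lsc_comp f_lsc fst_c).
    exact: (lsc_comp g_lsc snd_c).
  - apply: lsc_continuous => w; rewrite /Q.
    apply: cvgD; apply: cvgM; try exact: cvg_cst.
    + rewrite expr2; under eq_fun do rewrite expr2.
      by apply: cvgM; apply: cvg_norm; (apply: cvgB; [exact: fst_c|exact: cvg_cst]).
    + rewrite expr2; under eq_fun do rewrite expr2.
      have Lc := bounded_operator_continuous L_bounded.
      have h : L x.1 - r - x.2 @[x --> w] --> L w.1 - r - w.2.
        apply: cvgB; last exact: snd_c.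
        apply: cvgB; last exact: cvg_cst.
        by apply: continuous_comp; [exact: fst_c|exact: Lc].
      by apply: cvgM; apply: cvg_norm.
have sum_real (w : W) (a : R) : (Phi w <= a%:E)%E -> exists p q : R,
    [/\ f w.1 = p%:E, g w.2 = q%:E & p + q + Q k w.1 w.2 <= a].
  rewrite /Phi; move: (f_gtNy w.1) (g_gtNy w.2).
  case: (f _) => [p| |]//; case: (g _) => [q| |]// _ _.
  by rewrite -!EFinD lee_fin; exists p, q.
have [w [wfin wmin]] : exists w, Phi w \is a fin_num /\ forall y, (Phi w <= Phi y)%E.
  apply: (@strongly_convex_minimizer _ _ Phi c (- K)) => //.
  - by move=> u d; exact: cvgn_sqr_bound_pair.
  - move=> w; apply: (le_trans _ (KQ w.1 w.2)).
    by rewrite lee_fin lerDl mulr_ge0// invr_ge0.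
  - exists (u0, p0); rewrite /Phi/=.
    have [a ->] := ereal_real (f_gtNy u0) fu0.
    by have [b ->] := ereal_real (g_gtNy p0) gp0; rewrite -!EFinD ltry.
  - move=> w w' a b /sum_real[p [q [fp gq pqa]]] /sum_real[p' [q' [fp' gq' pqb]]].
    rewrite /Phi/=.
    have h := leeD (econvex_midpoint f_convex fp fp') (econvex_midpoint g_convex gq gq').
    rewrite -addeA; apply: (le_trans (leeD2r _ h)).
    rewrite -!EFinD lee_fin prod_normE/=.
    have := coupled_midpoint k0 (ltW M0) LM w.1 w.2 w'.1 w'.2; rewrite -/c; lra.
exists w.1, w.2; move: wfin wmin; rewrite /Phi.
move: (f_gtNy w.1) (g_gtNy w.2); case: (f _) => [p| |]//; case: (g _) => [q| |]// _ _ _ wmin.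
by split => // u' p'; exact: (wmin (u', p')).
Qed.

(** Fermat's rule in each variable separately. The vector [w] plays the role of the adjoint applied
    to [v]; it is a hypothesis because the Riesz theorem, hence the adjoint, is derived below from
    this very minimization. *)
Lemma coupled_optimality (k : R) (u : H) (p : G) : 0 < k ->
  f u \is a fin_num -> g p \is a fin_num ->
  (forall u' p', (f u + g p + (Q k u p)%:E <= f u' + g p' + (Q k u' p')%:E)%E) ->
  let v := k *: (L u - r - p) in
  subgrad g p v /\
  forall w, (forall y, dotp (L y) v = dotp y w) -> subgrad f u (z - u - w).
Proof.
move=> k0 fu gp umin v; split.
- apply: (@subgrad_of_minimizer _ _ g (Q k u) p v (fun d => k / 2 * `|d| ^+ 2)) => //.
    move=> y; have := umin u y.
    by rewrite -!addeA leeD2lE.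
  move=> d t _; rewrite /Q.
  have -> : L u - r - (p + t *: d) = L u - r - p - t *: d by rewrite opprD addrA.
  rewrite /v; move: (L u - r - p) => a; rewrite -!dotpxx !dotpE (dotpC d a).
  by rewrite le_eqVlt; apply/orP; left; apply/eqP; field.
- move=> w wv.
  apply: (@subgrad_of_minimizer _ _ f (Q k ^~ p) u (z - u - w)
    (fun d => 2^-1 * `|d| ^+ 2 + k / 2 * `|L d| ^+ 2)) => //.
    move=> y; have := umin y p.
    by rewrite addeAC [leRHS]addeAC leeD2rE.
  move=> d t _; rewrite /Q (linearD L) (linearZ_LR L).
  have -> : L u + t *: L d - r - p = (L u - r - p) + t *: L d.
    by rewrite (addrAC (L u)) (addrAC (L u - r)).
  have -> : u + t *: d - z = (u - z) + t *: d by rewrite addrAC.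
  have -> : z - u - w = - (u - z) - w by rewrite opprB.
  have := wv d; rewrite /v; move: (L u - r - p) (u - z) => a e; rewrite dotpZr => h; rewrite -!dotpxx !dotpE -h.
  rewrite (dotpC d e) (dotpC (L d) a).
  by rewrite le_eqVlt; apply/orP; left; apply/eqP; field.
Qed.

End coupled_minimization.

(** * Subgradients, conjugates and proximity operators *)

Section subgradients.
Context {R : realType} {V : hilbertType R}.
Implicit Types (phi : V -> \bar R) (p q s w : V).

(** Existence of proximal points is the degenerate coupled problem with zero first function, zero
    operator, [r = - w] and penalty weight [gamma]. *)
Lemma subgrad_scaled_exists phi (gamma : R) w :
  (forall y, (-oo < phi y)%E) -> lower_semicontinuous phi -> econvex phi ->
  (exists y, (phi y < +oo)%E) -> 0 < gamma ->
  exists p, subgrad phi p (gamma *: (w - p)).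
Proof.
move=> phiNy phil phic phip gamma0.
have zNy (y : V) : (-oo < (cst 0%E : V -> \bar R) y)%E by rewrite ltNyr.
have zl : lower_semicontinuous (cst 0%E : V -> \bar R).
  by apply: (@lsc_continuous _ _ (cst 0)); exact: cst_continuous.
have zc : econvex (cst 0%E : V -> \bar R).
  by move=> t x y _; rewrite /= !mule0 adde0.
have Lb : bounded_operator (\0 : {linear V -> V}).
  by exists 0 => x /=; rewrite mul0r normr0.
have [u [p [fu gp umin]]] := coupled_minimizer 0 (- w) zNy zl zc phiNy phil phic Lb
  gamma0 (ex_intro _ 0 (ltry 0)) phip.
have [h _] := coupled_optimality zNy zc phiNy phic gamma0 fu gp umin.
by exists p; move: h; rewrite /= sub0r opprK.
Qed.

Lemma subgrad_monotone phi p q s w :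
  subgrad phi p s -> subgrad phi q w -> 0 <= dotp (p - q) (s - w).
Proof.
move=> [pf hp] [qf hq]; move: (hp q) (hq p).
rewrite -(fineK pf) -(fineK qf) -!EFinD !lee_fin !dotpE; lra.
Qed.

(** The subgradient inequality makes the objective exceed its value at [p] by at least
    [|y - p|^2 / 2], so [p] is the only minimizer and [xget] must return it. *)
Lemma prox_subgrad phi p w : subgrad phi p (w - p) -> prox phi w = p.
Proof.
move=> [pf hp].
have key y : (moreau_objective phi w p + (2^-1 * `|y - p| ^+ 2)%:E <=
              moreau_objective phi w y)%E.
  rewrite /moreau_objective -addeA -EFinD.
  have -> : 2^-1 * `|w - p| ^+ 2 + 2^-1 * `|y - p| ^+ 2 =
      dotp (y - p) (w - p) + 2^-1 * `|w - y| ^+ 2.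
    by rewrite -!dotpxx !dotpE (dotpC p w) (dotpC y w) (dotpC y p); field.
  by rewrite EFinD addeA; apply: leeD2r.
have pmin : minimizers (moreau_objective phi w) p.
  move=> y; apply: le_trans (key y); apply: leeDl; rewrite lee_fin.
  by apply: mulr_ge0; rewrite ?invr_ge0 ?sqr_ge0.
apply: xget_subset1 => // q q' qmin q'min.
suff uniq y : minimizers (moreau_objective phi w) y -> y = p.
  by rewrite (uniq q)// (uniq q').
move=> /(_ p) /(le_trans (key y)); rewrite /moreau_objective -(fineK pf) -!EFinD lee_fin.
rewrite gerDl => h; apply/eqP; rewrite -subr_eq0 -normr_eq0 -sqrf_eq0 -dotpxx.
by rewrite eq_le dotp_ge0 dotpxx andbT; lra.
Qed.

Lemma conjugate_ge phi p w : phi p \is a fin_num ->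
  ((dotp p w)%:E - phi p <= conjugate phi w)%E.
Proof. by move=> pf; apply: ereal_sup_ubound; exists p. Qed.

Lemma conjugate_subgrad phi p s : subgrad phi p s ->
  conjugate phi s = ((dotp p s)%:E - phi p)%E.
Proof.
move=> [pf hp]; apply/eqP; rewrite eq_le conjugate_ge// andbT.
apply: ge_ereal_sup => _ [y _ <-]; move: (hp y); rewrite -(fineK pf).
case: (phi y) => [c| |]// h; last by rewrite leNye.
by move: h; rewrite -!EFinD !lee_fin dotpDl dotpNl; lra.
Qed.

Lemma subgrad_conjugate phi p s : subgrad phi p s -> subgrad (conjugate phi) s p.
Proof.
move=> ps; have [pf _] := ps; rewrite /subgrad/= (conjugate_subgrad ps) -(fineK pf).
split => // w; apply: le_trans (conjugate_ge w pf); rewrite -{2}(fineK pf).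
by rewrite -!EFinD lee_fin (dotpC _ p) !dotpE; lra.
Qed.

(* Moreau's decomposition: [prox_(gamma g^* ) w = w - gamma q] with
   [q = prox_(g / gamma) (w / gamma)]. *)
Lemma prox_conjugate phi (gamma : R) w :
  (forall y, (-oo < phi y)%E) -> lower_semicontinuous phi -> econvex phi ->
  (exists y, (phi y < +oo)%E) -> 0 < gamma ->
  exists q, subgrad phi q (w - gamma *: q) /\
    prox (fun u => gamma%:E * conjugate phi u)%E w = w - gamma *: q.
Proof.
move=> phiNy phil phic phip gamma0.
have [q] := subgrad_scaled_exists (gamma^-1 *: w) phiNy phil phic phip gamma0.
rewrite scalerBr scalerA mulfV ?gt_eqF// scale1r => qs.
exists q; split => //; apply: prox_subgrad.
(* What remains is that [gamma *: q] is a subgradient of the scaled conjugate at [w - gamma *: q],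
   by inversion of the subdifferential. *)
rewrite opprB addrCA subrr addr0; have [cf hc] := subgrad_conjugate qs.
split; first by rewrite fin_numM.
move=> y; rewrite dotpZr EFinM -[X in (X + _)%E]/(gamma%:E * _)%E -muleDr//.
  by apply: lee_wpmul2l => //; rewrite lee_fin ltW.
exact: fin_num_adde_defr.
Qed.

End subgradients.

(** * Riesz representation, adjoint and orthogonal projection, obtained from proximal points *)

Lemma riesz {R : realType} (V : hilbertType R) (h : V -> R) (M : R) :
  (forall a x y, h (a *: x + y) = a * h x + h y) ->
  (forall x, `|h x| <= M * `|x|) -> exists p, forall x, h x = dotp x p.
Proof.
move=> hl hM.
have h0 : h 0 = 0.
  by apply/eqP; rewrite -normr_le0; have := hM 0; rewrite normr0 mulr0.
have hD x y : h (x + y) = h x + h y by rewrite -[x]scale1r hl mul1r scale1r.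
have hN x : h (- x) = - h x by rewrite -[- x]addr0 -scaleN1r hl mulN1r h0 addr0.
have hc : continuous h.
  move=> x; apply/cvgrPdist_lt => e e0.
  have M0 : 0 < `|M| + 1 by rewrite ltr_wpDl.
  apply/nbhs_ballP; exists (e / (`|M| + 1)) => /=; first exact: divr_gt0.
  move=> y; rewrite -ball_normE/= ltr_pdivlMr// mulrC => xy.
  rewrite -hN -hD (le_lt_trans (hM _))// (le_lt_trans _ xy)// ler_wpM2r//.
  by rewrite (le_trans (ler_norm M))// lerDl.
(* The proximal point of [- h] at [0] has subgradient [- p], that is [h d <= dotp d p] for all [d];
   replacing [d] by [- d] gives equality. *)
have [p [_ pmin]] : exists p, subgrad (fun x => (- h x)%:E) p (1 *: (0 - p)).
  apply: subgrad_scaled_exists => //.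
  - by move=> x; rewrite ltNyr.
  - by apply: lsc_continuous => x; apply: cvgN; exact: hc.
  - move=> t x y _; rewrite -!EFinM -EFinD lee_fin hl.
    by rewrite -[_ *: y]addr0 hl h0; lra.
  - by exists 0; rewrite ltry.
have hle d : h d <= dotp d p.
  have := pmin (p + d); rewrite -EFinD lee_fin hD scale1r sub0r dotpNr.
  by rewrite (addrAC p d) subrr add0r; lra.
exists p => x; apply/eqP; rewrite eq_le hle/=.
by have := hle (- x); rewrite hN dotpNl lerN2.
Qed.

Lemma adjointP {R : realType} (H G : hilbertType R) (L : {linear H -> G}) :
  bounded_operator L -> forall x y, dotp (L x) y = dotp x (adjoint L y).
Proof.
move=> [M LM] x y; move: x; rewrite /adjoint.
apply: (@xgetPex _ 0 [set h | forall x, dotp (L x) y = dotp x h]).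
apply: (@riesz _ _ _ (M * `|y|)).
- by move=> a x x'; rewrite linearP dotpDl dotpZl.
- move=> x; rewrite (le_trans (normr_dotp_le _ _))// mulrAC ler_wpM2r//.
Qed.

Lemma orthogonal_projection {R : realType} (V : hilbertType R) (S : set V) (w : V) :
  closed S -> S 0 -> (forall a x y, S x -> S y -> S (a *: x + y)) ->
  exists2 p, S p & forall y, S y -> dotp y (w - p) = 0.
Proof.
move=> Sc S0 Slin.
(* The indicator function of [S]: its proximal point at [w] is the projection, and a subgradient at
   a point of a subspace is orthogonal to the subspace. *)
pose i (x : V) : \bar R := if `[< S x >] then 0%E else +oo%E.
have iE x : S x -> i x = 0%E by move=> Sx; rewrite /i asboolT.
have iNE x : ~ S x -> i x = +oo%E by move=> Sx; rewrite /i asboolF.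
have [p [pf pmin]] : exists p, subgrad i p (1 *: (w - p)).
  apply: subgrad_scaled_exists => //.
  - by move=> x; rewrite /i; case: ifP; rewrite ?ltNyr.
  - move=> x a; have [Sx|Sx] := pselect (S x).
      rewrite iE// lte_fin => a0; exists setT; first exact: filterT.
      by move=> y _; rewrite /i; case: ifP; rewrite ?lte_fin ?ltry.
    move=> _; exists (~` S); last by move=> y Sy; rewrite iNE// ltry.
    by apply: open_nbhs_nbhs; split => //; exact: closed_openC.
  (* The endpoints are separate cases because [0 * +oo = 0]. *)
  - move=> t x y /andP[]; rewrite le_eqVlt => /orP[/eqP <- _|t0].
      by rewrite scale0r add0r subr0 scale1r mul0e add0e mul1e.
    rewrite le_eqVlt => /orP[/eqP ->|t1].
      by rewrite subrr scale0r addr0 scale1r mul0e adde0 mul1e.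
    have [Sx|Sx] := pselect (S x); last first.
      rewrite (iNE x)// gt0_muley ?lte_fin// addye ?leey//.
      rewrite /i; case: ifP => _; rewrite ?mule0// gt0_muley// lte_fin; lra.
    have [Sy|Sy] := pselect (S y); last first.
      by rewrite (iNE y)// gt0_muley ?lte_fin ?subr_gt0// addey ?leey// iE// mule0.
    rewrite !iE// ?mule0 ?adde0//; apply: (Slin) => //.
    by rewrite -[_ *: y]addr0; exact: Slin.
  - by exists 0; rewrite iE.
have Sp : S p by apply: contrapT => /iNE pE; move: pf; rewrite pE.
exists p => //.
have hle d : S d -> dotp d (w - p) <= 0.
  move=> Sd; have Spd : S (p + d) by rewrite -[p]scale1r; exact: Slin.
  have := pmin (p + d); rewrite !iE// add0e lee_fin scale1r.
  by rewrite addrAC subrr add0r.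
move=> y Sy; apply/eqP; rewrite eq_le hle//=.
have := hle (- y); rewrite dotpNl oppr_le0; apply.
by rewrite -[- y]addr0 -scaleN1r; exact: Slin.
Qed.

(** * Weak compactness along ultrafilters and Opial's argument *)

Section weak_limits.
Context {R : realType} {V : hilbertType R}.
Variables (v : nat -> V) (M : R).
Hypothesis vM : forall n, `|v n| <= M.

(** Against each [w] the inner products stay in a compact segment, where an ultrafilter converges;
    the limit is linear and bounded in [w], hence represented by a vector. *)
Lemma weak_ultralimit (U : set_system nat) : UltraFilter U ->
  exists l, forall w, dotp (v n) w @[n --> U] --> dotp l w.
Proof.
move=> UU; have UF : ProperFilter U := @ultra_proper _ _ UU.
have /choice[h hP] w : exists c : R, dotp (v n) w @[n --> U] --> c.
  have vw n : `|dotp (v n) w| <= M * `|w|.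
    by rewrite (le_trans (normr_dotp_le _ _))// ler_wpM2r.
  have [c [_ cc]] : `[- (M * `|w|), M * `|w|] `&` cluster (dotp (v n) w @[n --> U]) !=set0.
    apply: segment_compact; suff : \forall n \near U, dotp (v n) w \in `[- (M * `|w|), M * `|w|] by [].
    apply: filterE => n.
    by rewrite in_itv/= -ler_norml; exact: vw.
  exists c => A cA.
  have [//|UA] := in_ultra_setVsetC ((fun n => dotp (v n) w) @^-1` A) UU.
  by have [a []] := cc (~` A) A UA cA.
have hM w : `|h w| <= M * `|w|.
  have hn : `|dotp (v n) w| @[n --> U] --> `|h w| by apply: cvg_norm; exact: hP.
  apply: (cvgr_to_le hn).
  by apply: filterE => n; rewrite (le_trans (normr_dotp_le _ _))// ler_wpM2r.
have hl a x y : h (a *: x + y) = a * h x + h y.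
  apply: (cvg_unique (@Rhausdorff R) (hP _)).
  have -> : (fun n => dotp (v n) (a *: x + y)) =
      (fun n => a * dotp (v n) x + dotp (v n) y).
    by apply/funext => n; rewrite dotpDr dotpZr.
  by apply: cvgD; [apply: cvgM; [exact: cvg_cst|exact: hP]|exact: hP].
have [l lP] := riesz hl hM.
by exists l => w; rewrite dotpC -lP; exact: hP.
Qed.

(* Opial's argument: two weak ultralimits [l] and [l'] in [Z] coincide because
   [2 <v n, l' - l> = |v n - l|^2 - |v n - l'|^2 - |l|^2 + |l'|^2] converges. *)
Lemma opial (Z : set V) :
  (forall p, Z p -> cvgn (fun n => `|v n - p|)) ->
  (forall (U : set_system nat) l, UltraFilter U -> \oo `<=` U ->
    (forall w, dotp (v n) w @[n --> U] --> dotp l w) -> Z l) ->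
  exists2 l, Z l & weakly_cvg v l.
Proof.
move=> Zcvg Zlim.
have [U [UU ooU]] := @ultraFilterLemma _ (\oo : set_system nat) _.
have UF : ProperFilter U := @ultra_proper _ _ UU.
have [l lP] := weak_ultralimit UU.
have Zl := Zlim _ _ UU ooU lP; exists l => // w.
apply/cvgrPdist_lt => e e0; apply: contrapT => nfar.
(* If convergence fails against [w], the indices at distance at least [e] meet every tail, so some
   ultrafilter refining [\oo] contains [A]; the weak limit along it must still be [l], a
   contradiction. *)
pose A := [set n | ~ (`|dotp l w - dotp (v n) w| < e)].
have AF : ProperFilter (within A \oo).
  apply: Build_ProperFilter_ex => B AB; apply: contrapT => nB; apply: nfar.
  move: AB; rewrite /within/= ; apply: filterS => n nAB.
  by apply: contrapT => nA; apply: nB; exists n; apply: nAB.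
have [U' [UU' AU']] := @ultraFilterLemma _ (within A \oo) AF.
have UF' : ProperFilter U' := @ultra_proper _ _ UU'.
have ooU' : \oo `<=` U'.
  by move=> B ooB; apply: AU'; move: ooB; rewrite /within/=; apply: filterS.
have U'A : U' A by apply: AU'; rewrite /within/=; apply: filterE.
have [l' lP'] := weak_ultralimit UU'.
have Zl' := Zlim _ _ UU' ooU' lP'.
have [c cP] : exists c : R, dotp (v n) (l' - l) @[n --> \oo] --> c.
  have /cvg_ex[a aP] := Zcvg _ Zl; have /cvg_ex[b bP] := Zcvg _ Zl'.
  exists (2^-1 * (a * a - b * b - `|l| ^+ 2 + `|l'| ^+ 2)).
  have -> : (fun n => dotp (v n) (l' - l)) = (fun n =>
      2^-1 * (`|v n - l| * `|v n - l| - `|v n - l'| * `|v n - l'| - `|l| ^+ 2 + `|l'| ^+ 2)).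
    apply/funext => n; rewrite -!expr2 -!dotpxx !dotpE.
    by rewrite (dotpC l (v n)) (dotpC l' (v n)); field.
  apply: cvgM; first exact: cvg_cst.
  apply: cvgD; last exact: cvg_cst.
  apply: cvgB; last exact: cvg_cst.
  by apply: cvgB; apply: cvgM.
have e1 : dotp l (l' - l) = c.
  by apply: (cvg_unique (@Rhausdorff R) (lP _)) => B /cP; exact: ooU.
have e2 : dotp l' (l' - l) = c.
  by apply: (cvg_unique (@Rhausdorff R) (lP' _)) => B /cP; exact: ooU'.
have /eqP : l' - l = 0.
  by apply: dotpxx_eq0; rewrite {1}dotpDl dotpNl e1 e2 subrr.
rewrite subr_eq0 => /eqP ll'; move: lP'; rewrite ll' => /(_ w)/cvgrPdist_lt/(_ _ e0) near_l.
have [n [nA nl]] := filter_ex (filterI U'A near_l).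
exact: nA.
Qed.

End weak_limits.

(** * Uniform boundedness and the qualification condition *)

Lemma uniform_boundedness {R : realType} (V : hilbertType R) (v : nat -> V) :
  (forall y, exists B : R, forall n, `|dotp y (v n)| <= B) ->
  exists M, forall n, `|v n| <= M.
Proof.
move=> vB.
have : uniform_bounded (range (fun n y => dotp y (v n) : R^o)).
  apply: Banach_Steinhauss.
  - move=> _ [n _ <-]; split.
      move=> e; exists (e * `|v n|) => x xe.
      by rewrite (le_trans (normr_dotp_le _ _))// ler_wpM2r.
    by move=> a x y; rewrite dotpDl dotpZl.
  - by move=> x; have [B xB] := vB x; exists B => _ [n _ <-].
move=> /(_ 1)[M MP]; exists M => n.
have := MP _ (ex_intro2 _ _ n I erefl).
have [->|vn0] := eqVneq (v n) 0.
  by move=> /(_ 0); rewrite normr0 dotp0l normr0; apply.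
have vn0' : 0 < `|v n| by rewrite normr_gt0.
(* The functional attains the norm of [v n] at this unit vector. *)
move=> /(_ (`|v n|^-1 *: v n)); rewrite normrZ ger0_norm ?invr_ge0//.
rewrite mulVf ?gt_eqF// dotpZl dotpxx expr2 mulrA mulVf ?gt_eqF// mul1r normr_id.
exact.
Qed.

(** The cone of [C - r] lies in the span, which lies in its closure, which is the cone again. All
    three coincide: the span is closed and each of its vectors is a positive multiple of some
    [y - r]. *)
Lemma sri_closed_subspace {R : realType} (V : hilbertType R) (C : set V) (r : V) :
  sri C r -> exists S : set V,
    [/\ closed S, S 0, forall a x y, S x -> S y -> S (a *: x + y),
        forall y, C y -> S (y - r) &
        forall w, S w -> exists l y, [/\ 0 < l, C y & w = l *: (y - r)]].
Proof.
move=> [Cr]; set D := [set y - r | y in C] => coneE.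
have span_sub A : submod_closed (mem A) -> D `<=` A -> cone D `<=` A.
  move=> [A0 Alin] DA _ [l _ [d Dd <-]]; rewrite -[_ *: d]addr0.
  by apply/set_mem/Alin => //; apply/mem_set/DA.
have Dspan : D `<=` lspan D by move=> d Dd A [_]; apply.
have spanE : lspan D = cone D.
  apply/seteqP; split; first by rewrite coneE; exact: subset_closure.
  by move=> w cw A [Asub DA]; exact: (span_sub A).
exists (lspan D); split.
- by rewrite spanE coneE; exact: closed_closure.
- by move=> A [[A0 _] _]; exact: set_mem A0.
- move=> a x y Sx Sy A [Asub DA]; have [_ Alin] := Asub.
  by apply/set_mem/Alin; apply/mem_set; [exact: Sx|exact: Sy].
- by move=> y Cy; apply: Dspan; exists y.
- move=> w; rewrite spanE => -[l l0 [_ [y Cy <-] <-]].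
  by exists l, y.
Qed.

(** * Closedness of the subdifferential for mixed strong and weak limits *)

Section optimality.
Context {R : realType} {V : hilbertType R}.

Lemma subgrad_limit (F : set_system nat) {FF : ProperFilter F}
    (phi : V -> \bar R) (u a b : nat -> V) (u0 a0 b0 : V) (M : R) :
  (forall y, (-oo < phi y)%E) -> lower_semicontinuous phi ->
  u n @[n --> F] --> u0 -> a n @[n --> F] --> a0 ->
  (forall n, `|b n| <= M) ->
  (forall w, dotp (b n) w @[n --> F] --> dotp b0 w) ->
  (forall n, subgrad phi (u n) (a n + b n)) ->
  subgrad phi u0 (a0 + b0).
Proof.
move=> phiNy phil uu aa bM bb us.
have key y : (phi u0 + (dotp (y - u0) (a0 + b0))%:E <= phi y)%E.
  apply: (lsc_lim_le phil uu (c := fun n => dotp (y - u n) (a n + b n))); last first.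
    by move=> n; have [_] := us n.
  have -> : (fun n => dotp (y - u n) (a n + b n)) =
      (fun n => dotp (y - u n) (a n) + dotp (y - u n) (b n)).
    by apply/funext => n; rewrite dotpDr.
  have yu : y - u n @[n --> F] --> y - u0 by apply: cvgB => //; exact: cvg_cst.
  rewrite dotpDr; apply: cvgD; first exact: cvg_dotp.
  exact: (cvg_dotp_strong_weak yu bM).
(* Finiteness at the limit follows from [key] at [u 0], where [phi] is finite. *)
split => //; rewrite fin_numElt phiNy/=.
have [u0f _] := us 0; have := key (u 0); rewrite -(fineK u0f).
by case: (phi u0) => // r _; rewrite ltry.
Qed.

End optimality.

(** * Kuhn-Tucker pairs: existence, primal uniqueness, dual optimality *)

Section duality.
Context {R : realType} (H G : hilbertType R).
Variables (f : H -> \bar R) (g : G -> \bar R) (L : {linear H -> G}) (z : H) (r : G).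
Hypothesis f_gtNy : forall y, (-oo < f y)%E.
Hypothesis f_lsc : lower_semicontinuous f.
Hypothesis f_convex : econvex f.
Hypothesis g_gtNy : forall y, (-oo < g y)%E.
Hypothesis g_lsc : lower_semicontinuous g.
Hypothesis g_convex : econvex g.
Hypothesis L_bounded : bounded_operator L.

Definition kuhn_tucker (x : H) (v : G) :=
  subgrad f x (z - x - adjoint L v) /\ subgrad g (L x - r) v.

Lemma adjoint_weak (F : set_system nat) (v : nat -> G) (v0 : G) :
  (forall w, dotp (v n) w @[n --> F] --> dotp v0 w) ->
  forall w, dotp (- adjoint L (v n)) w @[n --> F] --> dotp (- adjoint L v0) w.
Proof.
move=> vv w.
have E y : dotp (- adjoint L y) w = dotp y (- L w).
  by rewrite dotpNl dotpC -adjointP// dotpNr dotpC.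
by rewrite E (_ : (fun n => _) = (fun n => dotp (v n) (- L w)))//; apply/funext.
Qed.

Lemma adjoint_bounded : exists M, 0 < M /\ forall v, `|adjoint L v| <= M * `|v|.
Proof.
have [M [M0 LM]] := bounded_operator_gt0 L_bounded; exists M; split => // v.
have [->|n0] := eqVneq (adjoint L v) 0; first by rewrite normr0 mulr_ge0// ltW.
have n0' : 0 < `|adjoint L v| by rewrite normr_gt0.
rewrite -(ler_pM2l n0') -expr2 -dotpxx -adjointP//.
rewrite (le_trans (dotp_le _ _))// mulrA ler_wpM2r// mulrC; exact: LM.
Qed.

(** Serves twice: with [c = 0] for the penalized problems, and with [c] the gap between the backward
    point and [v n] for the algorithm. *)
Lemma kuhn_tucker_limit (F : set_system nat) {FF : ProperFilter F}
    (u : nat -> H) (p v c : nat -> G) (x : H) (v0 : G) (M : R) :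
  u n @[n --> F] --> x -> p n @[n --> F] --> L x - r -> c n @[n --> F] --> 0 ->
  (forall n, `|v n| <= M) ->
  (forall w, dotp (v n) w @[n --> F] --> dotp v0 w) ->
  (forall n, subgrad f (u n) (z - u n - adjoint L (v n))) ->
  (forall n, subgrad g (p n) (c n + v n)) ->
  kuhn_tucker x v0.
Proof.
move=> ux pLx c0 vM vv fu gp; split.
  have [A [A0 LA]] := adjoint_bounded.
  apply: (subgrad_limit f_gtNy f_lsc ux (a := fun n => z - u n) (M := A * M)
    (b := fun n => - adjoint L (v n))) => //.
  - by apply: cvgB => //; exact: cvg_cst.
  - by move=> n; rewrite normrN (le_trans (LA _))// ler_pM2l.
  - exact: adjoint_weak.
rewrite -[v0]add0r.
exact: (subgrad_limit g_gtNy g_lsc pLx c0 vM vv).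
Qed.

(* The coupling constraint [L u - r = p] is penalized with weight [n + 1]; the
   multipliers stay in the closed subspace spanned by
   [L (dom f) - dom g - r], on which the qualification condition bounds them
   pointwise. *)
Lemma kuhn_tucker_exists :
  sri [set y1 - y2 | y1 in L @` edom f & y2 in edom g] r ->
  exists x v, kuhn_tucker x v.
Proof.
set C := [set y1 - y2 | y1 in L @` edom f & y2 in edom g] => r_sri.
have [S [Scl S0 Slin CS Scone]] := sri_closed_subspace r_sri.
have [[_ [u0 fu0 <-] [p0 gp0 rE]] _] := r_sri.
have [K KQ] := coupled_coercive z r f_gtNy f_lsc f_convex g_gtNy g_lsc g_convex
  L_bounded ltr01.
have k0 n : 0 < n.+1%:R :> R by rewrite ltr0n.
have /choice[w wP] : forall n, exists w : H * G, [/\ f w.1 \is a fin_num,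
    g w.2 \is a fin_num & forall u' p',
    (f w.1 + g w.2 + (2^-1 * `|w.1 - z| ^+ 2 + n.+1%:R / 2 * `|L w.1 - r - w.2| ^+ 2)%:E <=
     f u' + g p' + (2^-1 * `|u' - z| ^+ 2 + n.+1%:R / 2 * `|L u' - r - p'| ^+ 2)%:E)%E].
  move=> n; have [u [p uP]] := coupled_minimizer z r f_gtNy f_lsc f_convex g_gtNy g_lsc
    g_convex L_bounded (k0 n) (ex_intro _ u0 fu0) (ex_intro _ p0 gp0).
  by exists (u, p).
pose u n := (w n).1; pose p n := (w n).2.
pose v n : G := n.+1%:R *: (L (u n) - r - p n).
have fuf n : f (u n) \is a fin_num by have [] := wP n.
have gpf n : g (p n) \is a fin_num by have [] := wP n.
have opt n : subgrad g (p n) (v n) /\ subgrad f (u n) (z - u n - adjoint L (v n)).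
  have [a1 a2 a3] := wP n.
  have [h1 h2] := coupled_optimality f_gtNy f_convex g_gtNy g_convex (k0 n) a1 a2 a3.
  by split => //; apply: h2 => y; exact: adjointP.
have vdef n : v n = n.+1%:R *: (L (u n) - r - p n) by [].
clearbody v.
have vE n : n.+1%:R^-1 *: v n = L (u n) - r - p n.
  by rewrite vdef scalerA mulVf ?scale1r// gt_eqF.
pose Q n := 2^-1 * `|u n - z| ^+ 2 + 2^-1 * `|L (u n) - r - p n| ^+ 2.
have Q0 n : 0 <= Q n by rewrite addr_ge0// mulr_ge0// ?sqr_ge0// invr_ge0.
(* Comparison with the feasible pair [(u0, p0)], where the penalty vanishes; coercivity at weight
   [1] suffices because the actual weight [n.+1%:R] is at least [1]. *)
have [N NQ] : exists N, forall n, Q n <= N.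
  have [a fa] := ereal_real (f_gtNy u0) fu0; have [b gb] := ereal_real (g_gtNy p0) gp0.
  exists (2 * (a + b + 2^-1 * `|u0 - z| ^+ 2 + K)) => n.
  have h0 : L u0 - r - p0 = 0 by rewrite -rE opprB addrCA subrr addr0 subrr.
  have [_ _ /(_ u0 p0)] := wP n; rewrite fa gb h0 normr0 expr0n/= mulr0 addr0.
  have := KQ (u n) (p n); rewrite -/(u n) -/(p n) -(fineK (fuf n)) -(fineK (gpf n)).
  rewrite -!EFinD !lee_fin => h1 h2.
  have kn : 1 <= n.+1%:R :> R by rewrite ler1n.
  have : 2^-1 * `|L (u n) - r - p n| ^+ 2 <= n.+1%:R / 2 * `|L (u n) - r - p n| ^+ 2.
    by rewrite ler_wpM2r ?sqr_ge0//; lra.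
  move: h1 h2; rewrite /Q; lra.
have uN n : `|u n - z| <= 1 + 2 * N.
  have : 0 <= 2^-1 * `|L (u n) - r - p n| ^+ 2 by rewrite mulr_ge0// ?sqr_ge0// invr_ge0.
  by have := NQ n; rewrite /Q; have := sqr_ge0 (`|u n - z| - 2^-1); nra.
(* Add the two subgradient inequalities at a pair [(u', p')] with [y = L u' - p']: the multiplier
   terms combine into [- dotp (y - r) (v n)] plus [dotp (L (u n) - r - p n) (v n)], which is
   nonnegative. *)
have Cbound y : C y -> exists B, forall n, - dotp (y - r) (v n) <= B.
  move=> [_ [u' fu' <-] [p' gp' <-]].
  have [a fa] := ereal_real (f_gtNy u') fu'; have [b gb] := ereal_real (g_gtNy p') gp'.
  exists (a + b + K + 2^-1 * N + `|u' - z| * (1 + 2 * N)) => n.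
  have [[_ /(_ p') hg] [_ /(_ u') hf]] := opt n.
  move: hg hf (KQ (u n) (p n)); rewrite fa gb -(fineK (fuf n)) -(fineK (gpf n)).
  rewrite -!EFinD !lee_fin mul1r -/(Q n) => hg hf hK.
  have := NQ n.
  have : 0 <= dotp (L (u n) - r - p n) (v n).
    by rewrite -vE dotpZl mulr_ge0 ?dotp_ge0// invr_ge0 ltW.
  have : - (`|u' - z| * (1 + 2 * N)) <= dotp (u' - z) (z - u n).
    rewrite lerNl -dotpNr opprB (le_trans (dotp_le _ _))// ler_wpM2l//.
  have := dotp_ge0 (z - u n).
  have := adjointP L_bounded (u' - u n) (v n); rewrite (linearB L).
  move: hf hg.
  rewrite !dotpE; lra.
(* One-sided bounds pass to positive multiples, hence to all of [S]; applied to [- y], they become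
   two-sided. *)
have Sbound y : S y -> exists B, forall n, `|dotp y (v n)| <= B.
  have half x : S x -> exists B, forall n, - dotp x (v n) <= B.
    move=> /Scone[l [y' [l0 /Cbound[B BP] ->]]]; exists (l * B) => n.
    by rewrite dotpZl -mulrN ler_pM2l.
  move=> Sy; have [B1 B1P] := half _ Sy.
  have [|B2 B2P] := half (- y).
    by rewrite -[- y]addr0 -scaleN1r; exact: Slin.
  exists (`|B1| + `|B2|) => n; rewrite ler_norml.
  have := B1P n; have := B2P n; rewrite dotpNl opprK.
  by have := ler_norm B1; have := ler_norm B2; have := normr_ge0 B1; have := normr_ge0 B2; lra.
have Sv n : S (v n).
  rewrite vdef -[_ *: _]addr0; apply: (Slin) => //; rewrite addrAC; apply: CS.
  exists (L (u n)); first by exists (u n) => //; rewrite /edom/= ltey_eq fuf.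
  by exists (p n) => //; rewrite /edom/= ltey_eq gpf.
(* As [v n] lies in [S], a test vector may be replaced by its projection on [S], so the pointwise
   bounds hold on the whole space. *)
have [M vM] : exists M, forall n, `|v n| <= M.
  apply: uniform_boundedness => y.
  have [q Sq qP] := orthogonal_projection y Scl S0 Slin.
  have [B BP] := Sbound q Sq; exists B => n.
  have := qP _ (Sv n); rewrite dotpC dotpDl dotpNl => /eqP; rewrite subr_eq0 => /eqP ->.
  exact: BP.
have inv0 : (n.+1%:R^-1 : R) @[n --> \oo] --> (0 : R) by exact: cvg_harmonic.
(* With [i], [j] the inverse weights, the two monotonicity inequalities give [|u n - u m|^2 <= -
   dotp (i v n - j v m) (v n - v m)], at most [(i + j) M^2]. *)
have /cvg_ex[x ux] : cvgn u.
  apply: (@cvgn_sqr_bound _ _ u (fun n => n.+1%:R^-1 * M ^+ 2)).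
    by rewrite -(mul0r (M ^+ 2)); apply: cvgM => //; exact: cvg_cst.
  move=> n m; have [gn fn] := opt n; have [gm fm] := opt m.
  have := subgrad_monotone fn fm; have := subgrad_monotone gn gm.
  have := adjointP L_bounded (u n - u m) (v n - v m).
  have := vE n; have := vE m; have := vM n; have := vM m.
  have A y y' : dotp y (adjoint L y') = dotp (L y) y' by rewrite adjointP.
  set i := n.+1%:R^-1; set j := m.+1%:R^-1.
  have i0 : 0 <= i by rewrite invr_ge0 ltW.
  have j0 : 0 <= j by rewrite invr_ge0 ltW.
  move=> vmM vnM em en _.
  have -> : p n = L (u n) - r - i *: v n by rewrite en opprB addrCA subrr addr0.
  have -> : p m = L (u m) - r - j *: v m by rewrite em opprB addrCA subrr addr0.
  have hM : dotp (v n) (v m) <= M ^+ 2.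
    by rewrite (le_trans (dotp_le _ _))// expr2 ler_pM.
  have h1 : 0 <= i * dotp (v n) (v n) by rewrite mulr_ge0 ?dotp_ge0.
  have h2 : 0 <= j * dotp (v m) (v m) by rewrite mulr_ge0 ?dotp_ge0.
  have h3 : i * dotp (v n) (v m) <= i * M ^+ 2 by rewrite ler_wpM2l.
  have h4 : j * dotp (v n) (v m) <= j * M ^+ 2 by rewrite ler_wpM2l.
  rewrite -dotpxx !dotpE !A ?(dotpC (v m) (v n)) ?(dotpC (u m) (u n)).
  lra.
have vi0 : n.+1%:R^-1 *: v n @[n --> \oo] --> 0.
  apply: (@cvg_of_normB0 _ _ \oo _ _ _ (fun n => n.+1%:R^-1 * M)).
    move=> n; rewrite subr0 normrZ ger0_norm ?invr_ge0//.
    by rewrite ler_wpM2l// invr_ge0.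
  by rewrite -(mul0r M); apply: cvgM => //; exact: cvg_cst.
have pLx : p n @[n --> \oo] --> L x - r.
  have -> : p = (fun n => L (u n) - r - n.+1%:R^-1 *: v n).
    by apply/funext => n; rewrite vE opprB addrCA subrr addr0.
  rewrite -[L x - r]subr0; apply: cvgB => //; apply: cvgB; last exact: cvg_cst.
  by apply: (cvg_comp _ _ ux); exact: bounded_operator_continuous.
have [U [UU ooU]] := @ultraFilterLemma _ (\oo : set_system nat) _.
have UF : ProperFilter U := @ultra_proper _ _ UU.
have [v0 v0P] := weak_ultralimit vM UU.
exists x, v0; apply: (@kuhn_tucker_limit U UF u p v (fun=> 0) x v0 M) => //.
- by move=> B /ux; exact: ooU.
- by move=> B /pLx; exact: ooU.
- exact: cvg_cst.
- by move=> n; have [] := opt n.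
- by move=> n; rewrite add0r; have [] := opt n.
Qed.

(** The sum of the two subgradient inequalities at [y] puts the primal value at [x] above the one at
    [y] by at least [|x - y|^2 / 2]. *)
Lemma kuhn_tucker_primal_unique (x y : H) (v : G) :
  kuhn_tucker y v -> minimizers (primal f g L z r) x -> x = y.
Proof.
move=> [[fy hf] [gy hg]] /(_ y).
have := hf x; have := hg (L x - r); rewrite /primal -(fineK fy) -(fineK gy).
move: (f_gtNy x) (g_gtNy (L x - r)).
case: (f x) => [a| |]//; case: (g (L x - r)) => [b| |]//= _ _; rewrite -!EFinD !lee_fin.
have := adjointP L_bounded (x - y) v; rewrite (linearB L) => h h1 h2 h3.
apply/eqP; rewrite -subr_eq0 -normr_eq0 -sqrf_eq0 -dotpxx eq_le dotp_ge0 andbT.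
move: h h1 h2 h3; rewrite -!dotpxx !dotpE ?(dotpC y x) ?(dotpC z x) ?(dotpC z y); lra.
Qed.

Lemma kuhn_tucker_dual (x : H) (v : G) :
  kuhn_tucker x v -> minimizers (dual f g L z r) v.
Proof.
move=> [fx gx] v'; have [fxf _] := fx; have [gxf _] := gx.
pose a := fine (f x); pose b := fine (g (L x - r)).
have fa : f x = a%:E by rewrite fineK.
have gb : g (L x - r) = b%:E by rewrite fineK.
(* This number is [|z|^2 / 2] minus the primal value at [x]; it bounds the dual function from above
   at [v] by equality in Fenchel-Young, and from below everywhere. *)
have up : (dual f g L z r v <= (dotp x z - 2^-1 * `|x| ^+ 2 - a - b)%:E)%E.
  rewrite /dual (conjugate_subgrad gx) gb.
  have h : (moreau_envelope (conjugate f) (z - adjoint L v)%R <=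
      (dotp x (z - x - adjoint L v) - a + 2^-1 * `|x| ^+ 2)%:E)%E.
    apply: ereal_inf_lbound; exists (z - x - adjoint L v) => //.
    rewrite /moreau_objective (conjugate_subgrad fx) fa -!EFinD.
    by rewrite opprB addrA subrK opprB addrCA subrr addr0.
  apply: (le_trans (leeD2r _ (leeD2r _ h))); rewrite -!EFinD lee_fin.
  rewrite -dotpxx !dotpE -adjointP// (dotpC v r); lra.
apply: (le_trans up).
have low : ((dotp x (z - adjoint L v') - 2^-1 * `|x| ^+ 2 - a)%:E <=
    moreau_envelope (conjugate f) (z - adjoint L v')%R)%E.
  apply: le_ereal_inf_tmp => _ [y _ <-]; rewrite /moreau_objective.
  apply: le_trans (leeD2r _ (conjugate_ge y fxf)).
  rewrite fa -!EFinD lee_fin; move: (z - adjoint L v') => q.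
  have := dotp_ge0 (q - y - x); rewrite -!dotpxx !dotpE.
  rewrite ?(dotpC y x) ?(dotpC q x) ?(dotpC q y); lra.
rewrite /dual; apply: le_trans (leeD2r _ (leeD low (conjugate_ge v' gxf))).
rewrite gb -!EFinD lee_fin !dotpE -adjointP// (dotpC v' r); lra.
Qed.

End duality.

(** * The operator norm *)

Section operator_norm.
Context {R : realType} (H G : hilbertType R) (L : {linear H -> G}).
Hypothesis L_bounded : bounded_operator L.

Lemma opnorm_le x : `|L x| <= opnorm L * `|x|.
Proof.
have [M [M0 LM]] := bounded_operator_gt0 L_bounded.
have hub : has_ubound [set `|L x| | x in [set x : H | `|x| <= 1]].
  exists M => _ [y /= y1 <-]; rewrite (le_trans (LM y))// -[leRHS]mulr1.
  by rewrite ler_pM2l.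
have [->|x0] := eqVneq x 0; first by rewrite linear0 !normr0 mulr0.
have x0' : 0 < `|x| by rewrite normr_gt0.
rewrite -ler_pdivrMr//.
have -> : `|L x| / `|x| = `|L (`|x|^-1 *: x)|.
  by rewrite (linearZ_LR L) normrZ ger0_norm ?invr_ge0// mulrC.
apply: ub_le_sup => //; exists (`|x|^-1 *: x) => //=.
by rewrite normrZ ger0_norm ?invr_ge0// mulVf// gt_eqF.
Qed.

Lemma opnorm_gt0 : (exists x, L x != 0) -> 0 < opnorm L.
Proof.
move=> [x Lx0]; have := opnorm_le x.
have Lx : 0 < `|L x| by rewrite normr_gt0.
move=> /(lt_le_trans Lx); have [x0|x0] := eqVneq x 0.
  by rewrite x0 normr0 mulr0 ltxx.
by rewrite pmulr_lgt0// normr_gt0.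
Qed.

End operator_norm.

(** * Real sequences that decrease up to summable errors *)

Section real_sequences.
Context {R : realType}.
Implicit Types (t e u : nat -> R).

Lemma quasi_fejer_cvg t e : (forall n, 0 <= t n) -> (forall n, 0 <= e n) ->
  cvgn (series e) -> (forall n, t n.+1 <= t n + e n) -> cvgn t.
Proof.
move=> t0 e0 ec te.
(* Subtracting the accumulated errors leaves a nonincreasing sequence bounded below. *)
have dc : cvgn (fun n => t n - series e n).
  apply: nonincreasing_is_cvgn.
    apply/nonincreasing_seqP => n; rewrite seriesSr.
    by have := te n; lra.
  exists (- limn (series e)) => _ [n _ <-].
  have : series e n <= limn (series e).
    by apply: nondecreasing_cvgn_le => //; apply: nondecreasing_series => k _ _.
  by have := t0 n; lra.
have -> : t = (fun n => (t n - series e n) + series e n).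
  by apply/funext => n; rewrite subrK.
exact: is_cvgD.
Qed.

Lemma cvg_sqr0 t : t n ^+ 2 @[n --> \oo] --> 0 -> t n @[n --> \oo] --> 0.
Proof.
move=> /cvgrPdist_lt t0; apply/cvgrPdist_lt => e e0.
have := t0 (e ^+ 2) (exprn_gt0 _ e0); apply: filterS => n.
by rewrite !sub0r !normrN normrX ltr_pXn2r// ?nnegrE ?normr_ge0 ?(ltW e0).
Qed.

End real_sequences.

(** * One error-free relaxed forward-backward step on the dual *)

Section forward_backward.
Context {R : realType} (H G : hilbertType R).
Variables (f : H -> \bar R) (g : G -> \bar R) (L : {linear H -> G}) (z : H) (r : G).
Hypothesis L_bounded : bounded_operator L.
Hypothesis L_neq0 : exists y, L y != 0.

Let l := opnorm L.
Let l0 : 0 < l := opnorm_gt0 L_bounded L_neq0.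

(** The relation between [s] and [q] says, without [prox], that [s] is the backward point. The
    factor [eps ^+ 2 * l ^+ 2] is the gain of the forward step, the second square that of the
    backward step, and the outer [eps] a lower bound on the relaxation. *)
Lemma forward_backward_decrease (eps gamma lambda : R) (x y : H) (p v q s : G) :
  kuhn_tucker f g L z r x p ->
  subgrad f y (z - y - adjoint L v) -> subgrad g q s ->
  s = v + gamma *: (L y - r) - gamma *: q ->
  0 < eps -> eps <= gamma <= 2 * l ^- 2 - eps -> eps <= lambda <= 1 ->
  `|v + lambda *: (s - v) - p| ^+ 2 +
    eps * (eps ^+ 2 * l ^+ 2 * `|y - x| ^+ 2 + `|v - s + gamma *: L (y - x)| ^+ 2)
  <= `|v - p| ^+ 2.
Proof.
move=> [fx gx] fy gq sE eps0 /andP[epsg gl] /andP[epsl l1].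
have gamma0 : 0 < gamma by exact: lt_le_trans epsg.
have lambda0 : 0 < lambda by exact: lt_le_trans epsl.
(* Cocoercivity of the dual gradient, from monotonicity of the subdifferential of [f]. *)
have hf : `|y - x| ^+ 2 <= - dotp (L (y - x)) (v - p).
  have := subgrad_monotone fy fx.
  have := adjointP L_bounded (y - x) v; have := adjointP L_bounded (y - x) p.
  move: (L (y - x)) (adjoint L v) (adjoint L p) => Lyx av ap.
  by rewrite -dotpxx !dotpE (dotpC y x); lra.
pose d := (v - p) + gamma *: L (y - x).
(* Firm nonexpansiveness of the backward step, [d] being the difference of the two forward
   points. *)
have hg : `|s - p| ^+ 2 <= dotp d (s - p).
  have := subgrad_monotone gq gx; rewrite -(ler_pM2l gamma0) mulr0 -dotpZl.
  have -> : gamma *: (q - (L x - r)) = d - (s - p).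
    rewrite /d sE (linearB L); apply: dotp_inj => ?; rewrite !dotpE; ring.
  by rewrite dotpDl dotpNl dotpxx; lra.
have Lyx : `|L (y - x)| ^+ 2 <= l ^+ 2 * `|y - x| ^+ 2.
  rewrite -exprMn lerXn2r ?nnegrE ?mulr_ge0 ?(ltW l0)//; exact: opnorm_le.
have gl2 : gamma * l ^+ 2 <= 2 - eps * l ^+ 2.
  have l20 : 0 < l ^+ 2 by rewrite exprn_gt0.
  have := ler_wpM2r (ltW l20) gl; rewrite mulrBl -mulrA mulVf ?mulr1// gt_eqF//.
set Y := `|y - x| ^+ 2 in hf Lyx *.
have Y0 : 0 <= Y by exact: sqr_ge0.
(* The upper bound on [gamma] enters through [gamma * (2 - gamma * l ^+ 2) >= eps ^+ 2 * l ^+ 2]. *)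
have dd : dotp d d <= dotp (v - p) (v - p) - eps ^+ 2 * l ^+ 2 * Y.
  have -> : dotp d d = dotp (v - p) (v - p) + 2 * gamma * dotp (L (y - x)) (v - p)
      + gamma ^+ 2 * `|L (y - x)| ^+ 2.
    rewrite -dotpxx /d; move: (v - p) (L (y - x)) => A B.
    by rewrite !dotpE (dotpC A B); ring.
  have h1 : gamma * Y <= gamma * - dotp (L (y - x)) (v - p) by rewrite ler_pM2l.
  have h2 : gamma ^+ 2 * `|L (y - x)| ^+ 2 <= gamma ^+ 2 * (l ^+ 2 * Y).
    by rewrite ler_wpM2l// sqr_ge0.
  have h3 : gamma * Y * (gamma * l ^+ 2) <= gamma * Y * (2 - eps * l ^+ 2).
    by rewrite ler_wpM2l// mulr_ge0// ltW.
  have h4 : eps * (eps * l ^+ 2 * Y) <= gamma * (eps * l ^+ 2 * Y).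
    by rewrite ler_wpM2r// !mulr_ge0 ?sqr_ge0// ltW.
  lra.
have -> : v - s + gamma *: L (y - x) = d - (s - p).
  by rewrite /d; apply: dotp_inj => ?; rewrite !dotpE; ring.
set D := eps ^+ 2 * l ^+ 2 * Y + _.
have D0 : 0 <= D.
  by apply: addr_ge0; [apply: mulr_ge0 => //; apply: mulr_ge0|]; exact: sqr_ge0.
have sD : `|s - p| ^+ 2 <= `|v - p| ^+ 2 - D.
  have sq (A C : G) : `|C - A| ^+ 2 = dotp C C - 2 * dotp C A + `|A| ^+ 2.
    by rewrite -!dotpxx !dotpE (dotpC A C); ring.
  by move: hg dd; rewrite /D (sq _ d) -(dotpxx (v - p)); lra.
have e1 : eps * D <= lambda * D by rewrite ler_wpM2r.
have e2 : lambda * `|s - p| ^+ 2 <= lambda * (`|v - p| ^+ 2 - D) by rewrite ler_pM2l.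
have -> : v + lambda *: (s - v) - p = (1 - lambda) *: (v - p) + lambda *: (s - p).
  by apply: dotp_inj => ?; rewrite !dotpE; ring.
have cv : `|(1 - lambda) *: (v - p) + lambda *: (s - p)| ^+ 2 <=
    (1 - lambda) * `|v - p| ^+ 2 + lambda * `|s - p| ^+ 2.
  have : 0 <= lambda * (1 - lambda) * dotp ((v - p) - (s - p)) ((v - p) - (s - p)).
    by rewrite mulr_ge0 ?dotp_ge0// mulr_ge0// ?subr_ge0// ltW.
  rewrite -!dotpxx; move: (v - p) (s - p) => A B.
  by rewrite !dotpE (dotpC B A); nra.
lra.
Qed.

End forward_backward.

(** * The proximity operators of a function and of its scaled conjugate *)

Section proximity_operator.
Context {R : realType} {V : hilbertType R} (phi : V -> \bar R).
Hypothesis phiNy : forall y, (-oo < phi y)%E.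
Hypothesis phi_lsc : lower_semicontinuous phi.
Hypothesis phi_convex : econvex phi.
Hypothesis phi_proper : exists y, (phi y < +oo)%E.

Lemma subgrad_prox w : subgrad phi (prox phi w) (w - prox phi w).
Proof.
have [p] := subgrad_scaled_exists w phiNy phi_lsc phi_convex phi_proper ltr01.
by rewrite scale1r => hp; rewrite (prox_subgrad hp).
Qed.

Lemma prox_conjugate_nonexpansive (gamma : R) w w' : 0 < gamma ->
  `|prox (fun u => gamma%:E * conjugate phi u)%E w -
    prox (fun u => gamma%:E * conjugate phi u)%E w'| <= `|w - w'|.
Proof.
move=> gamma0.
have [q [qs ->]] := prox_conjugate w phiNy phi_lsc phi_convex phi_proper gamma0.
have [q' [qs' ->]] := prox_conjugate w' phiNy phi_lsc phi_convex phi_proper gamma0.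
have := subgrad_monotone qs qs'; set d := (_ - _ - _).
rewrite -(ler_pM2l gamma0) mulr0 -dotpZl.
have -> : gamma *: (q - q') = (w - w') - d.
  by apply: dotp_inj => ?; rewrite !dotpE; ring.
rewrite dotpDl dotpNl dotpxx => h.
have := dotp_le (w - w') d; have [->//|d0] := eqVneq d 0.
  by rewrite normr0.
have d0' : 0 < `|d| by rewrite normr_gt0.
by move=> h'; rewrite -(ler_pM2r d0') -expr2; lra.
Qed.

End proximity_operator.

(** * Convergence of the inexact relaxed iteration *)

Theorem theorem3p7 (R : realType) (H G : hilbertType R) (z : H) (r : G)
    (f : H -> \bar R) (g : G -> \bar R) (L : {linear H -> G})
    (f_gtNy : forall y, (-oo < f y)%E)
    (f_lsc : lower_semicontinuous f) (f_convex : econvex f)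
    (g_gtNy : forall y, (-oo < g y)%E)
    (g_lsc : lower_semicontinuous g) (g_convex : econvex g)
    (L_bounded : bounded_operator L) (L_neq0 : exists y, L y != 0)
    (r_sri : sri [set y1 - y2 | y1 in L @` edom f & y2 in edom g] r)
    (x : H) (x_sol : minimizers (primal f g L z r) x)
    (a : nat -> G) (a_sum : (\sum_(0 <= n <oo) (`|a n|)%:E < +oo)%E)
    (b : nat -> H) (b_sum : (\sum_(0 <= n <oo) (`|b n|)%:E < +oo)%E)
    (eps : R) (eps_itv : 0 < eps < Num.min 1 (opnorm L ^- 2))
    (v0 : G)
    (gamma : nat -> R)
    (gamma_itv : forall n, eps <= gamma n <= 2 * opnorm L ^- 2 - eps)
    (lambda : nat -> R) (lambda_itv : forall n, eps <= lambda n <= 1)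
    (xs : nat -> H) (vs : nat -> G)
    (vs0 : vs 0%N = v0)
    (xsE : forall n, xs n = prox f (z - adjoint L (vs n)) + b n)
    (vsS : forall n, vs n.+1 = vs n + lambda n *:
       (prox (fun u => (gamma n)%:E * conjugate g u)%E
          (vs n + gamma n *: (L (xs n) - r)) + a n - vs n)) :
  (exists v, [/\ minimizers (dual f g L z r) v, weakly_cvg vs v
               & x = prox f (z - adjoint L v)]) /\
  xs n @[n --> \oo] --> x.
Proof.
have [[_ [u0 fu0 _] [p0 gp0 _]] _] := r_sri.
have f_proper : exists y, (f y < +oo)%E by exists u0.
have g_proper : exists y, (g y < +oo)%E by exists p0.
have l0 := opnorm_gt0 L_bounded L_neq0; set l := opnorm L in l0 gamma_itv.
have eps0 : 0 < eps by case/andP: eps_itv.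
have gamma0 n : 0 < gamma n by have /andP[/(lt_le_trans eps0)] := gamma_itv n.
have lambda0 n : 0 < lambda n by have /andP[/(lt_le_trans eps0)] := lambda_itv n.
have [x' [p xp]] := kuhn_tucker_exists z f_gtNy f_lsc f_convex g_gtNy g_lsc g_convex
  L_bounded r_sri.
(* Identifying [x'] with the given solution lets every dual point below be paired with the same
   [x]. *)
have xx' := kuhn_tucker_primal_unique f_gtNy g_gtNy L_bounded xp x_sol.
rewrite -{}xx' in xp.
pose y n := prox f (z - adjoint L (vs n)).
have ysub n : subgrad f (y n) (z - y n - adjoint L (vs n)).
  by rewrite addrAC; exact: subgrad_prox.
pose w n := vs n + gamma n *: (L (y n) - r).
pose T n := prox (fun u => (gamma n)%:E * conjugate g u)%E.
have /choice[q qP] : forall n, exists q,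
    subgrad g q (w n - gamma n *: q) /\ T n (w n) = w n - gamma n *: q.
  by move=> n; exact: prox_conjugate.
pose s n := w n - gamma n *: q n.
have qs n : subgrad g (q n) (s n) by have [] := qP n.
have Ts n : T n (w n) = s n by have [] := qP n.
(* [c] bounds every [gamma n * l], so [e n] bounds the effect of both errors on the dual iterate:
   [b n] passes through [gamma n *: L] and a nonexpansive map. *)
pose c := 2 * l ^- 2 * l.
pose e n := c * `|b n| + `|a n|.
have c0 : 0 <= c by rewrite !mulr_ge0// ?invr_ge0 ?exprn_ge0// ltW.
have gammac n : gamma n * l <= c.
  by have /andP[_ h] := gamma_itv n; rewrite ler_wpM2r//; [exact: ltW|lra].
have e0 n : 0 <= e n by rewrite addr_ge0// mulr_ge0.
have a_cvg : cvgn (series (fun n => `|a n|)) by exact: nnseries_is_cvg.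
have b_cvg : cvgn (series (fun n => `|b n|)) by exact: nnseries_is_cvg.
have e_cvg : cvgn (series e).
  have -> : e = (c *: (fun n => `|b n|)) + (fun n => `|a n|) by apply/funext.
  by apply: is_cvg_seriesD => //; exact: is_cvg_seriesZ.
pose u n := vs n + lambda n *: (s n - vs n).
have vsu n : `|vs n.+1 - u n| <= e n.
  have -> : vs n.+1 - u n = lambda n *: (T n (vs n + gamma n *: (L (xs n) - r)) - T n (w n) + a n).
    rewrite vsS /u -/(T n) Ts; move: (T n _) => t.
    by apply: dotp_inj => ?; rewrite !dotpE; ring.
  have /andP[_ l1] := lambda_itv n.
  rewrite normrZ gtr0_norm// -[leRHS]mul1r ler_pM// ?(ltW (lambda0 n))//.
  rewrite (le_trans (ler_normD _ _))// lerD2r.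
  apply: le_trans (prox_conjugate_nonexpansive g_gtNy g_lsc g_convex g_proper _ _ (gamma0 n)) _.
  have -> : vs n + gamma n *: (L (xs n) - r) - w n = gamma n *: L (b n).
    rewrite xsE -/(y n) (linearD L) /w.
    by apply: dotp_inj => ?; rewrite !dotpE; ring.
  rewrite normrZ gtr0_norm// (le_trans (ler_wpM2l (ltW (gamma0 n)) (opnorm_le L_bounded _)))//.
  by rewrite mulrA ler_wpM2r.
pose D n := eps * (eps ^+ 2 * l ^+ 2 * `|y n - x| ^+ 2 +
  `|vs n - s n + gamma n *: L (y n - x)| ^+ 2).
have D0 n : 0 <= D n.
  apply: mulr_ge0; first exact: ltW.
  by apply: addr_ge0; [apply: mulr_ge0; [apply: mulr_ge0|]|]; exact: sqr_ge0.
have step p' n : kuhn_tucker f g L z r x p' -> `|u n - p'| ^+ 2 + D n <= `|vs n - p'| ^+ 2.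
  move=> xp'; apply: (forward_backward_decrease L_bounded L_neq0 xp' (ysub n) (qs n)) => //.
have u_le p' n : kuhn_tucker f g L z r x p' -> `|u n - p'| <= `|vs n - p'|.
  move=> /(step _ n) h; rewrite -(@ler_pXn2r _ 2)// ?nnegrE//.
  by have := D0 n; lra.
have vsS_le p' n : `|vs n.+1 - p'| <= `|u n - p'| + e n.
  have -> : vs n.+1 - p' = (u n - p') + (vs n.+1 - u n) by rewrite [RHS]addrC addrA subrK.
  by rewrite (le_trans (ler_normD _ _))// lerD2l.
have vs_cvg p' : kuhn_tucker f g L z r x p' -> cvgn (fun n => `|vs n - p'|).
  move=> xp'; apply: (quasi_fejer_cvg (e := e)) => // n.
  by rewrite (le_trans (vsS_le p' n))// lerD2r u_le.
have /cvg_ex[tau tauP] := vs_cvg p xp.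
have e_0 : e n @[n --> \oo] --> 0 by exact: cvg_series_cvg_0.
have tauS : `|vs n.+1 - p| @[n --> \oo] --> tau by rewrite (cvg_shiftS (fun n => `|vs n - p|)).
(* The error-free iterate is squeezed between consecutive actual ones, so the decrease [D n] lies
   below a difference of two sequences with the same limit. *)
have u_tau : `|u n - p| @[n --> \oo] --> tau.
  apply: (@squeeze_cvgr _ _ _ _ (fun n => `|vs n.+1 - p| - e n) (fun n => `|vs n - p|)) => //.
    by apply: nearW => n; rewrite u_le// andbT lerBlDr.
  by rewrite -[tau]subr0; exact: cvgB.
have D_0 : D n @[n --> \oo] --> 0.
  apply: (@squeeze_cvgr _ _ _ _ (cst 0) (fun n => `|vs n - p| ^+ 2 - `|u n - p| ^+ 2)).
  - by apply: nearW => n; rewrite D0/= lerBrDr addrC step.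
  - exact: cvg_cst.
  - rewrite -(subrr (tau ^+ 2)); under eq_fun do rewrite !expr2.
    by rewrite expr2; apply: cvgB; apply: cvgM.
have sqr_0 (t : nat -> R) k : 0 < k -> (forall n, k * t n ^+ 2 <= D n) ->
    t n @[n --> \oo] --> 0.
  move=> k0 tD; apply: cvg_sqr0.
  apply: (@squeeze_cvgr _ _ _ _ (cst 0) (fun n => k^-1 * D n)).
  - by apply: nearW => n; rewrite sqr_ge0/= ler_pdivlMl.
  - exact: cvg_cst.
  - by rewrite -(mulr0 k^-1); apply: cvgM => //; exact: cvg_cst.
have yx0 : `|y n - x| @[n --> \oo] --> 0.
  apply: (sqr_0 _ (eps * (eps ^+ 2 * l ^+ 2))) => [|n].
    by rewrite !mulr_gt0 ?exprn_gt0.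
  by rewrite -mulrA ler_pM2l// lerDl sqr_ge0.
pose m n := vs n - s n + gamma n *: L (y n - x).
have m0 : `|m n| @[n --> \oo] --> 0.
  apply: (sqr_0 _ eps) => // n; rewrite ler_pM2l// lerDr.
  by apply: mulr_ge0; [apply: mulr_ge0|]; exact: sqr_ge0.
have y_x : y n @[n --> \oo] --> x by apply: (cvg_of_normB0 _ yx0).
have q_x : q n @[n --> \oo] --> L x - r.
  apply: (@cvg_of_normB0 _ _ _ _ _ _ (fun n => eps^-1 * `|m n|)) => [n|]; last first.
    by rewrite -(mulr0 eps^-1); apply: cvgM => //; exact: cvg_cst.
  (* The residual [m n] is exactly [gamma n *: (q n - (L x - r))], and [gamma n] is at least
     [eps]. *)
  have -> : q n - (L x - r) = (gamma n)^-1 *: m n.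
    apply: (scalerI (lt0r_neq0 (gamma0 n))); rewrite scalerA mulfV ?gt_eqF// scale1r.
    rewrite /m /s /w (linearB L).
    by apply: dotp_inj => ?; rewrite !dotpE; ring.
  rewrite normrZ gtr0_norm ?invr_gt0// ler_wpM2r// lef_pV2 ?posrE//.
  by have /andP[] := gamma_itv n.
have sv_0 : s n - vs n @[n --> \oo] --> 0.
  apply: (@cvg_of_normB0 _ _ _ _ _ _ (fun n => `|m n| + c * `|y n - x|)) => [n|]; last first.
    rewrite -(addr0 0) -[X in _ + X](mulr0 c); apply: cvgD => //.
    by apply: cvgM => //; exact: cvg_cst.
  have -> : s n - vs n - 0 = - m n + gamma n *: L (y n - x).
    by rewrite subr0 /m opprD opprB subrK.
  rewrite (le_trans (ler_normD _ _))// normrN lerD2l normrZ gtr0_norm//.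
  rewrite (le_trans (ler_wpM2l (ltW (gamma0 n)) (opnorm_le L_bounded _)))//.
  by rewrite mulrA ler_wpM2r.
have [M vM] : exists M, forall n, `|vs n| <= M.
  have [B [_ BP]] := cvg_seq_bounded (vs_cvg p xp).
  exists (B + 1 + `|p|) => n; rewrite -[vs n](subrK p) (le_trans (ler_normD _ _))// lerD2r.
  have B1 : B < B + 1 by rewrite ltrDl.
  by have := BP _ B1 n I; rewrite /= normr_id.
split; last first.
  have b0 : b n @[n --> \oo] --> 0.
    apply: (@cvg_of_normB0 _ _ _ _ _ _ (fun n => `|b n|)) => [n|].
      by rewrite subr0.
    exact: cvg_series_cvg_0.
  have -> : xs = (fun n => y n + b n) by apply/funext => n; rewrite xsE.
  by rewrite -[x]addr0; exact: cvgD.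
(* Opial's argument for the set of all [v] forming a Kuhn-Tucker pair with [x]; the subgradient
   [s n] is written as the vanishing [s n - vs n] plus the weakly convergent [vs n]. *)
have [v xv vsv] : exists2 v, kuhn_tucker f g L z r x v & weakly_cvg vs v.
  apply: (opial vM) => // U v UU ooU vsv.
  have UF : ProperFilter U := @ultra_proper _ _ UU.
  apply: (@kuhn_tucker_limit _ _ _ f g L z r f_gtNy f_lsc g_gtNy g_lsc L_bounded U UF
    y q vs (fun n => s n - vs n) x v M) => //.
  - by move=> B /y_x; exact: ooU.
  - by move=> B /q_x; exact: ooU.
  - by move=> B /sv_0; exact: ooU.
  - by move=> n; rewrite subrK.
exists v; split => //; first exact: kuhn_tucker_dual xv.
by apply/esym/prox_subgrad; have [] := xv; rewrite addrAC.
Qed.
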